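(* Let $s\in(0,1)$, let $\Omega\subset\mathbb{R}^n$ be a bounded open set containing the origin, and let $r:=\operatorname{dist}(0,\partial\Omega)$. Suppose that $$u(0)=\frac{1}{\mu_r(\mathbb{R}^n\setminus\Omega)}\int_{\mathbb{R}^n\setminus\Omega}u(y)\,d\mu_r(y)$$ for all functions $u\in\mathcal{H}^s(\Omega)$. Then $\Omega=B_r$.
   Context: $B_r$ is the open ball of radius $r$ centered at the origin. The fractional Laplacian is $(-\Delta)^su(x):=P.V.\int_{\mathbb{R}^n}\frac{u(x)-u(x-y)}{|y|^{n+2s}}\,dy$. $\mathcal{H}^s(\Omega)$ is the set of all $u\in C(\mathbb{R}^n)$ with $\int_{\mathbb{R}^n}\frac{|u(y)|}{1+|y|^{n+2s}}\,dy<+\infty$ and $(-\Delta)^su=0$ in $\Omega$ (it is understood that $u$ is smooth enough in $\Omega$, say $C^2$, for the fractional Laplacian to be defined pointwise there). $\mu_r$ is the measure on $\mathbb{R}^n\setminus B_r$ given by $d\mu_r(y):=\frac{c(n,s)\,r^{2s}}{(|y|^2-r^2)^s|y|^n}\,dy$, where $c(n,s)>0$ is the normalizing constant (independent of $r$) such that $\mu_r(\mathbb{R}^n\setminus B_r)=1$. *)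

(* Defs.v *)
From HB Require Import structures.
From mathcomp Require Import all_boot all_order all_algebra.
From mathcomp Require Import all_classical all_reals all_analysis.
From mathcomp Require Import measurable_realfun.

Set Implicit Arguments.
Unset Strict Implicit.
Unset Printing Implicit Defensive.
Import Order.TTheory GRing.Theory Num.Theory.
Import numFieldNormedType.Exports.
Local Open Scope classical_set_scope.
Local Open Scope ring_scope.

Definition measure_rV_display : measure_display -> measure_display.
Proof. exact. Qed.

(* The sigma-algebra on ['rV[T]_n] generated by the coordinates, as for
   [n.-tuple T]; for [T] the real line it is the Borel sigma-algebra. *)
Section measurable_rV.
Context {d} {T : measurableType d} (n : nat).

Let coors : 'I_n -> 'rV[T]_n -> T := fun i x => x ord0 i.

Let rV_set0 : g_sigma_preimage coors set0.
Proof. exact: sigma_algebra0. Qed.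

Let rV_setC A : g_sigma_preimage coors A -> g_sigma_preimage coors (~` A).
Proof. exact: sigma_algebraC. Qed.

Let rV_bigcup (F : _^nat) : (forall i, g_sigma_preimage coors (F i)) ->
  g_sigma_preimage coors (\bigcup_i (F i)).
Proof. exact: sigma_algebra_bigcup. Qed.

HB.instance Definition _ := @isMeasurable.Build (measure_rV_display d)
  'rV[T]_n (g_sigma_preimage coors) rV_set0 rV_setC rV_bigcup.

End measurable_rV.

Lemma measurable_coord d (T : measurableType d) n (i : 'I_n) :
  measurable_fun [set: 'rV[T]_n] (fun x => x ord0 i).
Proof.
move=> _ Y mY; rewrite setTI; apply: sub_sigma_algebra => /=.
rewrite -bigcup_seq/=; exists i => /=; first by rewrite mem_index_enum.
by exists Y => //; rewrite setTI.
Qed.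

Lemma measurable_fun_coordP d1 d2 (T1 : measurableType d1)
    (T2 : measurableType d2) n (f : T1 -> 'rV[T2]_n) :
  (forall i, measurable_fun [set: T1] (fun x => f x ord0 i)) ->
  measurable_fun [set: T1] f.
Proof.
move=> mf; suff prefS : g_sigma_preimage (fun i x => f x ord0 i) `<=` measurable.
  move=> _ A mA; apply: prefS.
  by rewrite (g_sigma_preimage_comp (fun i (x : 'rV[T2]_n) => x ord0 i) f); exists A.
apply: smallest_sub; first exact: sigma_algebra_measurable.
case: n => [|n] in f mf *; first by rewrite big_ord0.
rewrite -bigcup_mkord_ord; apply: bigcup_sub => i Ii.
by move=> A [B mB <-]; exact: mf.
Qed.

Section lebesgue_rV.
Local Open Scope ereal_scope.
Variable R : realType.

Definition rV_cons n (p : 'rV[R]_n * R) : 'rV[R]_n.+1 :=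
  row_mx (p.2%:M : 'rV_1) p.1.

Lemma measurable_rV_cons n : measurable_fun setT (@rV_cons n).
Proof.
apply: measurable_fun_coordP => i; case: (@split_ordP 1 n i) => j ->.
  apply: (eq_measurable_fun snd) => // -[y a] _.
  by rewrite (@row_mxEl _ 1 1 n) mxE (ord1 j).
apply: (eq_measurable_fun ((fun y : 'rV[R]_n => y ord0 j) \o fst)).
  by move=> -[y a] _; rewrite /= (@row_mxEr _ 1 1 n).
by apply: measurableT_comp; [exact: measurable_coord|exact: measurable_fst].
Qed.

Section successor.
Variables (n : nat) (m : {measure set 'rV[R]_n -> \bar R}).

Definition lebesgue_rVS : set 'rV[R]_n.+1 -> \bar R :=
  pushforward (m \x @lebesgue_measure R) (@rV_cons n).

Let rVS0 : lebesgue_rVS set0 = 0.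
Proof. by rewrite /lebesgue_rVS /pushforward preimage_set0 measure0. Qed.

Let rVS_ge0 A : 0 <= lebesgue_rVS A.
Proof. by rewrite /lebesgue_rVS /pushforward measure_ge0. Qed.

Let rVS_sigma_additive : semi_sigma_additive lebesgue_rVS.
Proof. by apply: measure_semi_sigma_additive; exact: measurable_rV_cons. Qed.

HB.instance Definition _ := isMeasure.Build _ _ _ lebesgue_rVS
  rVS0 rVS_ge0 rVS_sigma_additive.

End successor.

(* The Lebesgue measure on R^n, as an iterated product. *)
Fixpoint lebesgue_rV n : {measure set 'rV[R]_n -> \bar R} :=
  if n is n'.+1 return {measure set 'rV[R]_n -> \bar R}
  then lebesgue_rVS (lebesgue_rV n') else \d_(0%R : 'rV[R]_0).

End lebesgue_rV.

Section euclidean.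
Variables (R : realType) (n : nat).

(* The library norm of ['rV[R]_n] is the sup norm; it has the same open,
   bounded and continuous notions as the Euclidean one. *)
Definition enorm (x : 'rV[R]_n) : R := Num.sqrt (\sum_(i < n) x ord0 i ^+ 2).

Definition eball (r : R) : set 'rV[R]_n := [set x | enorm x < r].

Definition dist_to (x : 'rV[R]_n) (A : set 'rV[R]_n) : R :=
  inf [set enorm (x - y) | y in A].

Definition boundary (A : set 'rV[R]_n) : set 'rV[R]_n :=
  closure A `\` interior A.

Lemma measurable_enorm : measurable_fun setT enorm.
Proof.
apply: (@measurableT_comp _ _ _ _ _ _ (@Num.sqrt R)).
  by apply: continuous_measurable_fun; exact: sqrt_continuous.
apply: measurable_sum => i.
by apply: measurable_funX; exact: measurable_coord.
Qed.

Lemma measurable_eball r : measurable (eball r).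
Proof.
rewrite (_ : eball r = setT `&` enorm @^-1` `]-oo, r[).
  by apply: measurable_enorm => //; exact: measurable_itv.
by apply/seteqP; split => x /=; rewrite ?in_itv//= => -[].
Qed.

End euclidean.

Section fractional_laplacian.
Variables (R : realType) (n : nat).
Implicit Types (s : R) (u : 'rV[R]_n -> R) (A : set 'rV[R]_n).

(* The principal value removes Euclidean balls around the singularity. *)
Definition frac_laplacian s u (x : 'rV[R]_n) : R :=
  lim ((\int[lebesgue_rV R n]_(y in ~` eball eps)
          ((u x - u (x - y)) / enorm y `^ (n%:R + 2 * s))) @[eps --> 0^'+]).

(* Continuity of all partial derivatives up to order [k] at the points of the
   open set [A]. *)
Fixpoint Ck (k : nat) A u : Prop :=
  (forall x, A x -> {for x, continuous u}) /\
  if k is k'.+1 then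
    forall i : 'I_n, (forall x, A x -> derivable u x (delta_mx ord0 i)) /\
      Ck k' A (fun x => 'D_(delta_mx ord0 i) u x)
  else True.

(* The second and third conditions ensure that the limit in [frac_laplacian]
   exists at the points of [A]. *)
Definition Hs s A u : Prop :=
  [/\ continuous u,
      (\int[lebesgue_rV R n]_y
         (`|u y| / (1 + enorm y `^ (n%:R + 2 * s)))%:E < +oo)%E,
      Ck 2 A u &
      forall x, A x -> frac_laplacian s u x = 0].

End fractional_laplacian.

Section mean_value_measure.
Variables (R : realType) (n : nat) (s : R).

Definition mean_kernel (r : R) (y : 'rV[R]_n) : R :=
  r `^ (2 * s) / ((enorm y ^+ 2 - r ^+ 2) `^ s * enorm y ^+ n).

(* The constant c(n,s), normalizing [mean_measure] below for [r = 1], hence for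
   all [r > 0]: substituting [y = r z], the integral of [mean_kernel r] outside
   the ball of radius [r] does not depend on [r]. *)
Definition mean_const : R :=
  (\int[lebesgue_rV R n]_(y in ~` eball 1) mean_kernel 1 y)^-1.

Definition mean_measure (r : R) (A : set 'rV[R]_n) : \bar R :=
  (\int[lebesgue_rV R n]_(y in A `\` eball r)
     (mean_const * mean_kernel r y)%:E)%E.

Let mean_kernel_ge0 r y : 0 <= mean_kernel r y.
Proof.
rewrite divr_ge0 ?powR_ge0// mulr_ge0 ?powR_ge0//.
by rewrite exprn_ge0 ?sqrtr_ge0.
Qed.

Let mean_const_ge0 : 0 <= mean_const.
Proof.
rewrite invr_ge0 fine_ge0//; apply: integral_ge0 => y _.
by rewrite lee_fin.
Qed.

Let mean_density_ge0 r y : (0 <= (mean_const * mean_kernel r y)%:E)%E.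
Proof. by rewrite lee_fin mulr_ge0. Qed.

Let measurable_mean_density r :
  measurable_fun setT (fun y => (mean_const * mean_kernel r y)%:E).
Proof.
have menorm := @measurable_enorm R n.
apply/measurable_EFinP; apply: measurable_funM => //.
apply: measurable_funM => //.
apply: (eq_measurable_fun (fun y =>
    ((enorm y ^+ 2 - r ^+ 2) `^ s * enorm y ^+ n) `^ (-1))).
  by move=> y _; rewrite powR_inv1// mulr_ge0 ?powR_ge0// exprn_ge0 ?sqrtr_ge0.
apply: (measurableT_comp (measurable_powR (-1))).
apply: measurable_funM; last exact: measurable_funX.
apply: (measurableT_comp (measurable_powR s)).
by apply: measurable_funB => //; exact: measurable_funX.
Qed.

Section instance.
Local Open Scope ereal_scope.
Variable r : R.

Let mean_measure0 : mean_measure r set0 = 0.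
Proof. by rewrite /mean_measure set0D integral_set0. Qed.

Let mean_measure_ge0 A : 0 <= mean_measure r A.
Proof. exact: integral_ge0. Qed.

Let mean_measure_sigma_additive : semi_sigma_additive (mean_measure r).
Proof.
move=> F mF tF mUF; rewrite /mean_measure; apply: cvg_toP.
  apply: ereal_nondecreasing_is_cvgn => k l kl.
  by apply: lee_sum_nneg_natr => // i _ _; exact: integral_ge0.
rewrite setD_bigcupl ge0_integral_bigcup//.
- by move=> k; apply: measurableD => //; exact: measurable_eball.
- exact: measurable_funTS.
- under eq_fun do rewrite setDE; exact: trivIset_setIr.
Qed.

HB.instance Definition _ := isMeasure.Build _ _ _ (mean_measure r)
  mean_measure0 mean_measure_ge0 mean_measure_sigma_additive.

End instance.

End mean_value_measure.

(* Main.v *)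
Require Import Defs.
From HB Require Import structures.
From mathcomp Require Import all_boot all_order all_algebra.
From mathcomp Require Import all_classical all_reals all_analysis.
From mathcomp Require Import measurable_realfun ring lra.

(** The ridge functions u_c(x) = (L + c x_i)_+^s, with c in {0, 1, -1} and L
    large, are s-harmonic in Omega because t_+^s is s-harmonic on the half-line
    and each restriction of u_c to a line is an affine reparametrization of it.
    The mean value formula for u_1 + u_{-1} over the complement of B_r reduces in
    the same way to an integral on each line through the origin.  Subtracting the
    assumed identities over the complement of Omega gives
      int_{Omega \ B_r} (2 L^s - u_1 - u_{-1}) dmu_r = 0,
    where u_0 = L^s shows that the measure of the complement of Omega is finite
    and not zero.  By strict concavity of t^s the integrand is positive off the
    hyperplane x_i = 0, so the set Omega \ B_r is negligible; as Omega is
    open, a point of Omega \ B_r would yield a whole cube in that set. *)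

Set Implicit Arguments.
Unset Strict Implicit.
Unset Printing Implicit Defensive.
Import Order.TTheory GRing.Theory Num.Theory.
Import numFieldNormedType.Exports.
Local Open Scope classical_set_scope.
Local Open Scope ring_scope.

(** * Integrals on open intervals *)

(** Harmonicity and the mean value formula both concern integrals over the complement of a ball, and
    one device serves for both. Polar coordinates are taken with the inverted radial variable w, so
    that on each ray the complement of the ball is a bounded interval and the Jacobian absorbs the
    dimension; homogeneity turns (l + b / w)_+^s into l^s w^(-s) (w + b / l)_+^s. The shifts b and
    -b always occur together: in the fractional Laplacian through the reflection y |-> - y, in the
    mean value formula because u_1 and u_{-1} are added. It is this pair that can be integrated: by
    the product rule up to a small error in the first case, by a change of variables to Euler's beta
    integral in the second. No constant is evaluated: c(n,s), the beta integral and the area of the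
    sphere are common factors, and c = 0 shows that 2 L^s and u_1 + u_{-1} have the same total
    integral. The one-dimensional integrands blow up at end points of their intervals, hence the
    preliminary results on open intervals. Nearly all integrands are kept nonnegative, so that
    Tonelli and monotone convergence apply at once; differences are formed only after finiteness is
    known. *)

Section integrals_on_open_intervals.
Context {R : realType}.
Implicit Types (a b c d : R) (f g F G phi : R -> R).
Notation mu := (@lebesgue_measure R).

(** Monotone convergence along an exhaustion by compact intervals. It carries the fundamental
    theorem and the substitution rule over to integrands that are singular at the end points. *)
Lemma cvg_shrinking_itv_integral (h : R -> \bar R) a b (al be : nat -> R) :
  (forall x, a < x < b -> (0 <= h x)%E) -> measurable_fun `]a, b[ h ->
  nonincreasing_seq al -> nondecreasing_seq be ->
  (forall k, a < al k) -> (forall k, be k < b) ->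
  al @ \oo --> a -> be @ \oo --> b ->
  (\int[mu]_(x in `[al k, be k]) h x)%E @[k --> \oo] -->
  (\int[mu]_(x in `]a, b[) h x)%E.
Proof.
move=> h0 mh ial ibe agt blt ala beb.
have -> : [set` `]a, b[] = \bigcup_k [set` `[al k, be k]].
  apply/seteqP; split => [x/=|x [k _]/=]; rewrite !in_itv/= => /andP[ax xb].
    have [k _ Pk] := filterI (cvgr_gt b beb _ xb) (cvgr_lt a ala _ ax).
    by exists k => //=; have [] := Pk k (leqnn k); rewrite in_itv/= => /ltW -> /ltW ->.
  by rewrite (lt_le_trans (agt k) ax) (le_lt_trans xb (blt k)).
have sub k : `[al k, be k] `<=` `]a, b[.
  move=> x/=; rewrite !in_itv/= => /andP[ax xb].
  by rewrite (lt_le_trans (agt k) ax) (le_lt_trans xb (blt k)).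
apply: ge0_nondecreasing_set_cvg_integral => //.
- move=> m n mn; apply/subsetPset => x/=; rewrite !in_itv/= => /andP[ax xb].
  by rewrite (le_trans (ial _ _ mn) ax) (le_trans xb (ibe _ _ mn)).
- by move=> k; apply: measurable_funS mh.
- by move=> k x /sub /=; rewrite in_itv/=; exact: h0.
Qed.

Let lo a b (k : nat) := a + (b - a) / k.+2%:R.
Let hi a b (k : nat) := b - (b - a) / k.+2%:R.

Let shrink a b : a < b -> [/\ nonincreasing_seq (lo a b),
   nondecreasing_seq (hi a b), forall k, a < lo a b k < hi a b k.+1 /\
     lo a b k <= hi a b k, forall k, hi a b k < b &
   (lo a b @ \oo --> a) /\ (hi a b @ \oo --> b)].
Proof.
move=> ab; have ba0 : 0 < b - a by rewrite subr_gt0.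
have cv : (b - a) / k.+2%:R @[k --> \oo] --> 0.
  rewrite -[X in _ --> X](mulr0 (b - a)); apply: cvgM; first exact: cvg_cst.
  by rewrite (cvg_shiftS (@harmonic R)); exact: cvg_harmonic.
have dk m n : (m <= n)%N -> (b - a) / n.+2%:R <= (b - a) / m.+2%:R.
  by move=> mn; rewrite ler_pM2l// lef_pV2 ?posrE// ler_nat.
have half k : (b - a) / k.+2%:R <= (b - a) / 2.
  by rewrite ler_pM2l// lef_pV2 ?posrE// ler_nat.
have p k : 0 < (b - a) / k.+2%:R by rewrite divr_gt0.
have lt k : (b - a) / k.+3%:R < (b - a) / k.+2%:R.
  by rewrite ltr_pM2l// ltf_pV2 ?posrE// ltr_nat.
split.
- by move=> m n mn; rewrite /lo lerD2l dk.
- by move=> m n mn; rewrite /hi lerD2l lerN2 dk.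
- move=> k; rewrite /lo /hi ltrDl p/=; split.
    by have := half k; have := lt k; move: (_ / k.+3%:R) (_ / k.+2%:R) => u v; lra.
  by have := half k; move: (_ / k.+2%:R) => u; lra.
- by move=> k; rewrite /hi gtrBl p.
split.
  rewrite -[X in _ --> X]addr0; apply: cvgD => //; exact: cvg_cst.
rewrite -[X in _ --> X]subr0; apply: cvgB => //; exact: cvg_cst.
Qed.

Lemma continuous_in_itv_within f a b c d : a < c -> d < b ->
  (forall x, a < x < b -> {for x, continuous f}) ->
  {within `[c, d], continuous f}.
Proof.
move=> ac db cf; apply: continuous_in_subspaceT => x.
rewrite inE/= in_itv/= => /andP[cx xd]; apply: cf.
by rewrite (lt_le_trans ac cx) (le_lt_trans xd db).
Qed.

Lemma measurable_fun_continuous_oo f a b :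
  (forall x, a < x < b -> {for x, continuous f}) -> measurable_fun `]a, b[ f.
Proof.
move=> cf; apply: open_continuous_measurable_fun; first exact: itv_open.
by move=> x; rewrite inE/= in_itv/=; exact: cf.
Qed.

(** Nonnegativity stands in for integrability at the end points: [F] need only be continuous there,
    and finiteness of the integral is part of the conclusion. *)
Lemma ge0_FTC2_oo f F a b : a < b ->
  (forall x, a < x < b -> 0 <= f x) ->
  (forall x, a < x < b -> {for x, continuous f}) ->
  (forall x, a < x < b -> is_derive x 1 F (f x)) ->
  continuous F ->
  (\int[mu]_(x in `]a, b[) (f x)%:E = (F b - F a)%:E)%E.
Proof.
move=> ab f0 cf dF cF.
have [s1 s2 s3 s4 [s5 s6]] := shrink ab.
have al k : a < lo a b k by have [/andP[]] := s3 k.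
(* For [k = 0] both [lo] and [hi] are the midpoint; the shift to [k.+1] makes the compact intervals
   nondegenerate. *)
have c1 : (\int[mu]_(x in `[lo a b k.+1, hi a b k.+1]) (f x)%:E)%E @[k --> \oo] -->
    (\int[mu]_(x in `]a, b[) (f x)%:E)%E.
  apply: cvg_shrinking_itv_integral => //.
  - by apply/measurable_EFinP; exact: measurable_fun_continuous_oo.
  - by move=> m n mn; exact: s1.
  - by move=> m n mn; exact: s2.
  - by rewrite (cvg_shiftS (lo a b)).
  - by rewrite (cvg_shiftS (hi a b)).
have lh k : lo a b k.+1 < hi a b k.+1.
  have [/andP[_ l1] _] := s3 k; apply: le_lt_trans l1; exact: s1.
have c2 : (F (hi a b k.+1) - F (lo a b k.+1))%:E @[k --> \oo] --> (F b - F a)%:E.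
  apply: cvg_EFin; first by near=> k.
  rewrite (_ : fine \o _ = fun k => F (hi a b k.+1) - F (lo a b k.+1))//.
  rewrite (cvg_shiftS (fun k => F (hi a b k) - F (lo a b k))).
  by apply: cvgB; apply: continuous_cvg => //; exact: cF.
rewrite -(cvg_lim (@ereal_hausdorff R) c1) -(cvg_lim (@ereal_hausdorff R) c2).
congr (limn _); apply/funext => k.
rewrite (@continuous_FTC2 _ f F) ?EFinB//.
- exact: (continuous_in_itv_within (al k.+1) (s4 k.+1)).
- split.
  + move=> x; rewrite in_itv/= => /andP[x1 x2].
    have xab : a < x < b by rewrite (lt_trans (al k.+1) x1) (lt_trans x2).
    by have [] := dF x xab.
  + by apply: cvg_at_right_filter; exact: cF.
  + by apply: cvg_at_left_filter; exact: cF.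
- move=> x; rewrite in_itv/= => /andP[x1 x2].
  have xab : a < x < b by rewrite (lt_trans (al k.+1) x1) (lt_trans x2).
  by rewrite derive1E; have [] := dF x xab.
Unshelve. all: by end_near. Qed.

(** [G] may be singular at [phi a] and [phi b], and [dphi] may vanish at [a] and [b]; the latter
    happens in [tpow_mean_value], where the substitution [v] has derivative [c] at 0 and [c] may be
    0. *)
Lemma ge0_substitution_oo phi dphi G a b : a < b ->
  (forall x, a <= x <= b -> is_derive x 1 phi (dphi x)) ->
  (forall x, a <= x <= b -> {for x, continuous dphi}) ->
  (forall x, a < x < b -> 0 < dphi x) ->
  (forall x, phi a < x < phi b -> 0 <= G x) ->
  (forall x, phi a < x < phi b -> {for x, continuous G}) ->
  (\int[mu]_(x in `]phi a, phi b[) (G x)%:E =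
   \int[mu]_(x in `]a, b[) (G (phi x) * dphi x)%:E)%E.
Proof.
move=> ab dp cdp dp0 G0 cG.
have cphi x : a <= x <= b -> {for x, continuous phi}.
  move=> /dp dpx; apply: differentiable_continuous.
  by apply/derivable1_diffP; exact: ex_derive.
have incr x y : a <= x -> x < y -> y <= b -> phi x < phi y.
  move=> ax xy yb.
  have [||z zxy E] := @MVT _ phi dphi x y xy.
  - move=> z; rewrite in_itv/= => /andP[xz zy].
    by apply: dp; rewrite (le_trans ax (ltW xz)) (le_trans (ltW zy) yb).
  - apply: continuous_in_subspaceT => z; rewrite inE/= in_itv/= => /andP[xz zy].
    by apply: cphi; rewrite (le_trans ax xz) (le_trans zy yb).
  rewrite -subr_gt0 E mulr_gt0 ?subr_gt0// dp0//.
  move: zxy; rewrite in_itv/= => /andP[xz zy].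
  by rewrite (le_lt_trans ax xz) (lt_le_trans zy yb).
have [s1 s2 s3 s4 [s5 s6]] := shrink ab.
have al k : a < lo a b k by have [/andP[]] := s3 k.
have lh k : lo a b k <= hi a b k by have [] := s3 k.
have incrW x y : a <= x -> x <= y -> y <= b -> phi x <= phi y.
  by move=> ax; rewrite le_eqVlt => /predU1P[->//|xy yb]; rewrite ltW// incr.
have albk k : lo a b k < b by rewrite (le_lt_trans (lh k)).
have abe k : a < hi a b k by rewrite (lt_le_trans (al k)).
have cGp x : a < x < b -> {for x, continuous (fun x => G (phi x) * dphi x)}.
  move=> /andP[ax xb]; apply: cvgM; last by apply: cdp; rewrite !ltW.
  apply: continuous_comp; first by apply: cphi; rewrite !ltW.
  by apply: cG; rewrite !incr// ltW.
have c1 : (\int[mu]_(x in `[phi (lo a b k), phi (hi a b k)]) (G x)%:E)%E @[k --> \oo] -->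
    (\int[mu]_(x in `]phi a, phi b[) (G x)%:E)%E.
  apply: (@cvg_shrinking_itv_integral _ _ _ (phi \o lo a b) (phi \o hi a b)) => //.
  - by apply/measurable_EFinP; exact: measurable_fun_continuous_oo.
  - by move=> m n mn; apply: incrW; [exact: ltW|exact: s1|exact: ltW].
  - by move=> m n mn; apply: incrW; [exact: ltW|exact: s2|exact: ltW].
  - by move=> k; apply: incr => //; exact: ltW.
  - by move=> k; apply: incr => //; exact: ltW.
  - by apply: continuous_cvg => //; apply: cphi; rewrite lexx ltW.
  - by apply: continuous_cvg => //; apply: cphi; rewrite lexx ltW.
have c2 : (\int[mu]_(x in `[lo a b k, hi a b k]) (G (phi x) * dphi x)%:E)%E @[k --> \oo] -->
    (\int[mu]_(x in `]a, b[) (G (phi x) * dphi x)%:E)%E.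
  apply: cvg_shrinking_itv_integral => //.
  - move=> x /andP[ax xb]; rewrite lee_fin mulr_ge0//.
      by apply: G0; rewrite !incr// ltW.
    by apply/ltW/dp0; rewrite ax.
  - by apply/measurable_EFinP; exact: measurable_fun_continuous_oo.
rewrite -(cvg_lim (@ereal_hausdorff R) c1) -(cvg_lim (@ereal_hausdorff R) c2).
congr (limn _); apply/funext => k.
have D x : a <= x <= b -> (phi^`())%classic x = dphi x.
  by move=> /dp dx; rewrite derive1E; have [] := dx.
have inab x : lo a b k <= x -> x <= hi a b k -> a < x < b.
  by move=> x1 x2; rewrite (lt_le_trans (al k) x1) (le_lt_trans x2).
have inabW x : lo a b k <= x -> x <= hi a b k -> a <= x <= b.
  by move=> x1 x2; have /andP[? ?] := inab x x1 x2; rewrite !ltW.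
have Dc x : a < x < b -> {for x, continuous (phi^`())%classic}.
  move=> xab; have := cdp x; rewrite /prop_for /continuous_at => /(_ _).
  have xabW : a <= x <= b by case/andP: xab => ? ?; rewrite !ltW.
  rewrite D// => /(_ xabW); apply: cvg_trans; apply: near_eq_cvg.
  near=> z; rewrite D//.
  have : z \in `]a, b[.
    by near: z; apply: near_in_itvoo; rewrite in_itv/=.
  by rewrite in_itv/= => /andP[? ?]; rewrite !ltW.
rewrite (@integration_by_substitution_increasing _ phi)//.
- apply: eq_integral => x; rewrite inE/= in_itv/= => /andP[x1 x2].
  by rewrite -(D _ (inabW _ x1 x2)).
- move=> x y; rewrite !in_itv/= => /andP[x1 x2] /andP[y1 y2] xy.
  by apply: incr => //; [rewrite (le_trans _ x1)// ltW|rewrite (le_trans y2)// ltW].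
- move=> x; rewrite in_itv/= => /andP[/ltW x1 /ltW x2]; apply: Dc; exact: inab.
- apply/cvg_ex; exists ((phi^`())%classic (lo a b k)); apply: cvg_at_right_filter.
  by apply: Dc; rewrite al/=.
- apply/cvg_ex; exists ((phi^`())%classic (hi a b k)); apply: cvg_at_left_filter.
  by apply: Dc; rewrite abe/=.
- split.
  + move=> x; rewrite in_itv/= => /andP[/ltW x1 /ltW x2].
    by have [] := dp x (inabW x x1 x2).
  + by apply: cvg_at_right_filter; apply: cphi; rewrite !ltW.
  + by apply: cvg_at_left_filter; apply: cphi; rewrite !ltW.
- by apply: (continuous_in_itv_within _ _ cG); apply: incr => //; exact: ltW.
Unshelve. all: by end_near. Qed.

Lemma ge0_integral_itvoo_split g a b c : a <= b <= c ->
  (forall x, 0 <= g x) -> measurable_fun setT g ->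
  (\int[mu]_(x in `]a, c[) (g x)%:E =
   \int[mu]_(x in `]a, b[) (g x)%:E + \int[mu]_(x in `]b, c[) (g x)%:E)%E.
Proof.
move=> /andP[ab bc] g0 mg.
have mgD D : measurable_fun D (fun x => (g x)%:E).
  by apply: measurable_funTS; exact/measurable_EFinP.
rewrite !integral_itv_bndo_bndc; try exact: mgD.
have -> : `]a, c]%classic = `]a, b] `|` `]b, c].
  by rewrite -itv_bndbnd_setU// ?bnd_simp.
rewrite ge0_integral_setU//.
- exact: mgD.
- by move=> x _; rewrite lee_fin.
- apply/disj_setPS => x [] /=; rewrite !in_itv/= => /andP[_ +] /andP[+ _].
  by rewrite ltNge => ->.
Qed.

Lemma ge0_integralD_fun (D : set R) f g : measurable D ->
  (forall x, 0 <= f x) -> (forall x, 0 <= g x) ->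
  measurable_fun D f -> measurable_fun D g ->
  (\int[mu]_(x in D) (f x + g x)%:E =
   \int[mu]_(x in D) (f x)%:E + \int[mu]_(x in D) (g x)%:E)%E.
Proof.
move=> mD f0 g0 mf mg; under eq_integral do rewrite EFinD.
rewrite ge0_integralD//.
- by move=> x _; rewrite lee_fin.
- exact/measurable_EFinP.
- by move=> x _; rewrite lee_fin.
- exact/measurable_EFinP.
Qed.

End integrals_on_open_intervals.

(** * Truncated powers on the line *)

Section truncated_power.
Context {R : realType}.
Implicit Types s t c k : R.
Notation mu := (@lebesgue_measure R).

Definition tpow s t : R := Num.max 0 t `^ s.

Lemma tpow_ge0 s t : 0 <= tpow s t. Proof. exact: powR_ge0. Qed.

Lemma tpowE s t : 0 <= t -> tpow s t = t `^ s.
Proof. by move=> t0; rewrite /tpow max_r. Qed.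

Lemma tpow_le0 s t : 0 < s -> t <= 0 -> tpow s t = 0.
Proof. by move=> s0 t0; rewrite /tpow max_l// powR0// gt_eqF. Qed.

Lemma tpowM s k t : 0 <= k -> tpow s (k * t) = k `^ s * tpow s t.
Proof.
move=> k0; rewrite /tpow -powRM ?le_max ?lexx// maxr_pMr// mulr0//.
Qed.

Lemma measurable_tpow s : measurable_fun setT (tpow s).
Proof.
apply: (measurableT_comp (measurable_powR s)).
by apply: measurable_maxr => //; exact: measurable_id.
Qed.

Lemma is_derive_tpow s t : 0 < t -> is_derive t 1 (tpow s) (s * t `^ (s - 1)).
Proof.
move=> t0; apply: (near_eq_is_derive _ (is_derive1_powR s t0)).
by near=> u; rewrite tpowE// ltW//; near: u; exact: lt_nbhsr.
Unshelve. all: by end_near. Qed.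

Lemma continuous_tpow s : 0 < s -> continuous (tpow s).
Proof.
move=> s0 t; have [t0|t0|->] := ltgtP t 0; last first.
- rewrite /continuous_at [X in _ --> X]tpow_le0//.
  apply/cvgrPdist_lt => e e0; rewrite near_simpl.
  near=> u; rewrite sub0r normrN ger0_norm ?tpow_ge0//.
  have [u0|u0] := leP u 0; first by rewrite tpow_le0.
  rewrite tpowE ?ltW// [ltRHS](_ : e = (e `^ s^-1) `^ s); last first.
    by rewrite -powRrM mulVf ?powRr1 ?ltW// gt_eqF.
  rewrite gt0_ltr_powR ?nnegrE ?ltW ?powR_gt0//.
  by near: u; apply: lt_nbhsl; rewrite powR_gt0.
- apply: differentiable_continuous; apply/derivable1_diffP.
  by have [] := is_derive_tpow s t0.
- rewrite /continuous_at tpow_le0 ?ltW//.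
  apply: cvg_near_cst; near=> u; apply/eqP; rewrite tpow_le0// ltW//.
  by near: u; exact: lt_nbhsl.
Unshelve. all: by end_near. Qed.

Lemma continuous_powR s t : 0 < t -> {for t, continuous (fun u : R => u `^ s)}.
Proof.
move=> t0; apply: differentiable_continuous; apply/derivable1_diffP.
by have [] := is_derive1_powR s t0.
Qed.

Lemma continuous_tpow_shift s be (x : R) : 0 < s ->
  {for x, continuous (fun u : R => tpow s (u + be))}.
Proof.
move=> s0; apply: (@continuous_comp _ _ _ (fun u : R => u + be) (tpow s)).
  by apply: cvgD; [exact: cvg_id|exact: cvg_cst].
exact: continuous_tpow.
Qed.

Lemma measurable_tpow_shift s a (be : R) :
  measurable_fun setT (fun w : R => tpow s (w + be) * w `^ a).
Proof.
apply: measurable_funM; last exact: measurable_powR.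
by apply: measurableT_comp; [exact: measurable_tpow|exact: measurable_funD].
Qed.

Lemma measurable_powR_shift s a (be : R) :
  measurable_fun setT (fun w : R => w `^ s * (w + be) `^ a).
Proof.
apply: measurable_funM; first exact: measurable_powR.
by apply: (measurableT_comp (measurable_powR _)); exact: measurable_funD.
Qed.

(** Translation by [be]: the truncation removes ]0, be[, and the shift moves to the other factor.
    The new integrand is the second summand of the product rule in [tpow_product_integral]. *)
Lemma tpow_shift_integral s (A be : R) : 0 < s -> 0 <= be < A ->
  (\int[mu]_(w in `]0%R, A[) (tpow s (w - be) * w `^ (s - 1))%:E =
   \int[mu]_(w in `]0%R, (A - be)%R[) (w `^ s * (w + be) `^ (s - 1))%:E)%E.
Proof.
move=> s0 /andP[be0 beA]; have Abe : 0 < A - be by rewrite subr_gt0.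
have f20 (w : R) : 0 <= tpow s (w - be) * w `^ (s - 1).
  by rewrite mulr_ge0 ?tpow_ge0 ?powR_ge0.
rewrite (@ge0_integral_itvoo_split _ _ 0 be A); first last.
- exact: measurable_tpow_shift.
- exact: f20.
- by rewrite be0/= ltW.
rewrite [X in (X + _)%E]integral0_eq ?add0e; last first.
  move=> x /=; rewrite in_itv/= => /andP[_ xbe].
  by rewrite tpow_le0 ?mul0r// subr_le0 ltW.
have := @ge0_substitution_oo R (fun w : R => w + be) (fun=> 1)
  (fun w => tpow s (w - be) * w `^ (s - 1)) 0 (A - be) Abe.
rewrite add0r subrK => S; apply: etrans; first apply: S; last first.
- apply: eq_integral => x; rewrite inE/= in_itv/= => /andP[x0 _].
  by rewrite mulr1 addrK tpowE// ltW.
- move=> x /andP[bx xA]; apply: cvgM; first exact: continuous_tpow_shift.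
  by apply: continuous_powR; exact: le_lt_trans bx.
- by move=> x _; exact: f20.
- by [].
- by move=> x _; exact: cvg_cst.
- move=> x _; rewrite -[X in is_derive _ _ _ X]addr0.
  exact: is_deriveD.
Qed.

(* The integrand is the derivative of (w (w + be))^s / s. *)
Lemma tpow_product_integral s (B be : R) : 0 < s -> 0 <= be -> 0 < B ->
  (\int[mu]_(w in `]0%R, B[) (tpow s (w + be) * w `^ (s - 1)
      + w `^ s * (w + be) `^ (s - 1))%:E
  = (B `^ s * (B + be) `^ s / s)%:E)%E.
Proof.
move=> s0 be0 B0.
apply: etrans; first apply: (@ge0_FTC2_oo R _
  (fun w => tpow s w * tpow s (w + be) / s)).
- exact: B0.
- by move=> x _; rewrite addr_ge0// mulr_ge0 ?tpow_ge0 ?powR_ge0.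
- move=> x /andP[x0 xA]; have xb : 0 < x + be by rewrite ltr_wpDr.
  apply: cvgD; apply: cvgM.
  + exact: continuous_tpow_shift.
  + exact: continuous_powR.
  + exact: continuous_powR.
  + apply: (@continuous_comp _ _ _ (fun u : R => u + be) (fun u : R => u `^ (s - 1))).
      by apply: cvgD; [exact: cvg_id|exact: cvg_cst].
    exact: continuous_powR.
- move=> x /andP[x0 xA]; have xb : 0 < x + be by rewrite ltr_wpDr.
  have d1 := is_derive_tpow s x0.
  have d2 : is_derive x 1 (fun w => tpow s (w + be)) (s * (x + be) `^ (s - 1)).
    rewrite -[X in is_derive _ _ _ X]mulr1.
    apply: (@is_derive1_comp _ (tpow s) (fun w => w + be)).
      exact: is_derive_tpow.
    by rewrite -[X in is_derive _ _ _ X]addr0; exact: is_deriveD.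
  have -> : (fun w => tpow s w * tpow s (w + be) / s) =
     s^-1 *: (tpow s * (fun w => tpow s (w + be))).
    by apply/funext => w; rewrite /GRing.scale/= mulrC.
  have -> : tpow s (x + be) * x `^ (s - 1) + x `^ s * (x + be) `^ (s - 1) =
      s^-1 *: (tpow s x *: (s * (x + be) `^ (s - 1))
      + tpow s (x + be) *: (s * x `^ (s - 1))).
    rewrite (tpowE s (ltW x0)) /GRing.scale/=.
    by field; rewrite gt_eqF.
  by apply: is_deriveZ; exact: is_deriveM.
- move=> x; apply: cvgM; last exact: cvg_cst.
  by apply: cvgM; [exact: continuous_tpow|exact: continuous_tpow_shift].
- congr (_%:E); rewrite (tpow_le0 _ (lexx 0))// !mul0r subr0.
  by rewrite !tpowE ?addr_ge0// ltW.
Qed.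

Lemma ger0_powRB1 s (x y : R) : s <= 1 -> 0 < x -> x <= y -> y `^ (s - 1) <= x `^ (s - 1).
Proof.
move=> s1 x0 xy; have y0 := lt_le_trans x0 xy.
rewrite -(opprB 1 s) !powRN lef_pV2 ?posrE ?powR_gt0//.
by rewrite ge0_ler_powR ?nnegrE ?subr_ge0// ltW.
Qed.

(** With x = be / A <= 1/2 one has (1 + x)^s <= 1 + x and (1 - x)^(s-1) <= 1 / (1 - x) <= 1 + 2 x,
    and (1 + x) (1 + 2 x) - 1 = 3 x + 2 x^2 <= 4 x. *)
Lemma powR_sum_estimate s (A be : R) : 0 < s < 1 -> 0 <= be -> 0 < A -> 2 * be <= A ->
  (A + be) `^ s * (A - be) `^ (s - 1) - A `^ s * A `^ (s - 1)
    <= 4 * be * A `^ (2 * s - 2).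
Proof.
move=> /andP[s0 s1] be0 A0 beA.
pose x := be / A.
have x0 : 0 <= x by rewrite divr_ge0// ltW.
have xh : x <= 1 / 2 by rewrite ler_pdivrMr//; lra.
have An0 : A != 0 by rewrite gt_eqF.
have u1 : (A + be) `^ s <= A `^ s * (1 + x).
  rewrite (_ : A + be = A * (1 + x)); last by rewrite /x; field.
  rewrite powRM ?(ltW A0)//; last lra.
  rewrite ler_pM2l ?powR_gt0//; apply: ler1_powR; lra.
have u2 : (A - be) `^ (s - 1) <= A `^ (s - 1) * (1 + 2 * x).
  rewrite (_ : A - be = A * (1 - x)); last by rewrite /x; field.
  rewrite powRM ?(ltW A0)//; last lra.
  rewrite ler_pM2l ?powR_gt0//.
  apply: (@le_trans _ _ ((1 - x) `^ (- 1))).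
    by apply: ger_powR; lra.
  rewrite powR_inv1; last lra.
  rewrite -[leLHS]mul1r ler_pdivrMr; last lra.
  nra.
have -> : A `^ (2 * s - 2) = A `^ s * A `^ (s - 1) / A.
  rewrite -powRD; last by apply/implyP.
  have -> : 2 * s - 2 = s + (s - 1) - 1 by ring.
  by rewrite [LHS]powRB ?powRr1 ?(ltW A0)//; apply/implyP.
have lb0 : 0 < A `^ s * A `^ (s - 1) by rewrite mulr_gt0 ?powR_gt0.
apply: (@le_trans _ _ (A `^ s * A `^ (s - 1) * ((1 + x) * (1 + 2 * x)) - A `^ s * A `^ (s - 1))).
  rewrite lerD2r.
  apply: (le_trans (ler_pM (powR_ge0 _ _) (powR_ge0 _ _) u1 u2)).
  by rewrite le_eqVlt; apply/orP; left; apply/eqP; ring.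
rewrite (_ : 4 * be * _ = A `^ s * A `^ (s - 1) * (4 * x)); last by rewrite /x; field.
rewrite -[X in _ - X]mulr1 -mulrBr ler_pM2l//; nra.
Qed.

Lemma powR_increment_lt s (A be : R) : 0 < be < A ->
  exists2 xi, A - be < xi < A & A `^ s - (A - be) `^ s = s * xi `^ (s - 1) * be.
Proof.
move=> /andP[be0 beA].
have [|z zab|z|z zab E] := @MVT R (fun u => u `^ s) (fun u => s * u `^ (s - 1)) (A - be) A.
- by rewrite gtrBl.
- apply: is_derive1_powR; move: zab; rewrite in_itv/=; lra.
- apply: continuous_in_subspaceT => u; rewrite inE/= in_itv/= => /andP[? ?].
  apply: continuous_powR; lra.
- by exists z; [move: zab; rewrite in_itv|rewrite E; ring].
Qed.

Lemma powR_increment s (A be : R) : 0 <= be < A ->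
  exists2 xi, A - be <= xi <= A & A `^ s - (A - be) `^ s = s * xi `^ (s - 1) * be.
Proof.
rewrite le_eqVlt => /andP[/predU1P[<-|be0] beA].
  by exists A; rewrite subr0 ?lexx// subrr mulr0.
have [|xi /andP[x1 x2] E] := @powR_increment_lt s A be; first by rewrite be0.
by exists xi; rewrite ?ltW.
Qed.

Lemma gt0_powRD (x a b : R) : 0 < x -> x `^ (a + b) = x `^ a * x `^ b.
Proof. by move=> x0; rewrite powRD// (gt_eqF x0) implybT. Qed.

Lemma gt0_powRV (x a : R) : 0 < x -> x^-1 `^ a = (x `^ a)^-1.
Proof. by move=> x0; rewrite -(powR_inv1 (ltW x0)) -powRrM mulN1r powRN. Qed.

Lemma powR_ge1 (x a : R) : 1 <= x -> 0 <= a -> 1 <= x `^ a.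
Proof.
move=> x1 a0; have := @ge0_ler_powR _ a a0 1 x; rewrite powR1 !nnegrE; apply => //.
exact: le_trans x1.
Qed.

Lemma gt0_powRB (x a b : R) : 0 < x -> x `^ (a - b) = x `^ a / x `^ b.
Proof. by move=> x0; rewrite gt0_powRD// powRN. Qed.

(* The (n = 1, half-line) form of the s-harmonicity of t_+^s: the error vanishes
   as A, the inverse of the radius of the excised ball, tends to infinity. *)
Lemma tpow_pair_integral s (A be : R) : 0 < s < 1 -> 0 <= be -> 0 < A -> 2 * be <= A ->
  exists2 e : R, `|e| <= 4 * be ^+ 2 * A `^ (2 * s - 2) &
   (\int[mu]_(w in `]0%R, A[) ((tpow s (w + be) + tpow s (w - be)) * w `^ (s - 1))%:E
    = (A `^ (2 * s) / s + e)%:E)%E.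
Proof.
move=> s01; have /andP[s0 s1] := s01; move=> be0 A0 beA.
have Abe : 0 < A - be by lra.
have beA' : 0 <= be < A by lra.
have mD a b (D : set R) : measurable D ->
    measurable_fun D (fun w => (tpow s (w + b) * w `^ a)%:E).
  move=> _; apply/measurable_EFinP; apply: measurable_funTS.
  exact: measurable_tpow_shift.
have t0 a b (w : R) : 0 <= tpow s (w + b) * w `^ a.
  by rewrite mulr_ge0 ?tpow_ge0 ?powR_ge0.
have p0 (w : R) : 0 <= w `^ s * (w + be) `^ (s - 1).
  by rewrite mulr_ge0 ?powR_ge0.
(* After translation the half with [w - be] lives on ]0, A - be[ and forms an exact derivative with
   the half with [w + be]. What remains of the latter is [J], over an interval of length [be]. *)
pose J := (\int[mu]_(w in `](A - be)%R, A[) (tpow s (w + be) * w `^ (s - 1))%:E)%E.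
have -> : (\int[mu]_(w in `]0%R, A[) ((tpow s (w + be) + tpow s (w - be)) * w `^ (s - 1))%:E
   = ((A - be) `^ s * A `^ s / s)%:E + J)%E.
  under eq_integral do rewrite mulrDl.
  rewrite ge0_integralD_fun; first last.
  - by apply: measurable_funTS; exact: measurable_tpow_shift.
  - by apply: measurable_funTS; exact: measurable_tpow_shift.
  - by move=> x; exact: t0.
  - by move=> x; exact: t0.
  - exact: measurable_itv.
  rewrite (tpow_shift_integral s0 beA').
  rewrite (@ge0_integral_itvoo_split _ _ 0 (A - be) A); first last.
  - exact: measurable_tpow_shift.
  - by move=> x; exact: t0.
  - by rewrite (ltW Abe) gerBl.
  rewrite addeAC; congr (_ + _)%E.
  rewrite -ge0_integralD_fun; first last.
  - by apply: measurable_funTS; exact: measurable_powR_shift.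
  - by apply: measurable_funTS; exact: measurable_tpow_shift.
  - exact: p0.
  - by move=> x; exact: t0.
  - exact: measurable_itv.
  by rewrite tpow_product_integral// subrK.
have powP (x y : R) : 0 <= x -> x <= y -> x `^ s <= y `^ s.
  by move=> x0 xy; rewrite ge0_ler_powR ?nnegrE ?(ltW s0)// (le_trans x0).
have powN := @ger0_powRB1 s _ _ (ltW s1).
have mA c : (\int[mu]_(w in `](A - be)%R, A[) (cst c%:E w) = (c * be)%:E)%E.
  rewrite integral_cst//= lebesgue_measure_itv/= lte_fin.
  case: ltP => h; first by rewrite -EFinD -EFinM; congr (_%:E); ring.
  by have -> : be = 0 by lra; rewrite mule0 mulr0.
pose lb := A `^ s * A `^ (s - 1).
pose ub := (A + be) `^ s * (A - be) `^ (s - 1).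
have R1 : ((lb * be)%:E <= J)%E.
  rewrite -mA; apply: ge0_le_integral.
  - exact: measurable_itv.
  - by move=> x _; rewrite lee_fin mulr_ge0 ?powR_ge0.
  - exact: measurable_cst.
  - exact: mD.
  - move=> x /=; rewrite in_itv/= => /andP[x1 x2].
    rewrite lee_fin /lb tpowE; last lra.
    by rewrite ler_pM ?powR_ge0//; [apply: powP; lra|apply: powN; lra].
have R2 : (J <= (ub * be)%:E)%E.
  rewrite -mA; apply: ge0_le_integral.
  - exact: measurable_itv.
  - by move=> x _; rewrite lee_fin; exact: t0.
  - exact: mD.
  - exact: measurable_cst.
  - move=> x /=; rewrite in_itv/= => /andP[x1 x2].
    rewrite lee_fin /ub tpowE; last lra.
    by rewrite ler_pM ?powR_ge0//; [apply: powP; lra|apply: powN; lra].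
have [rm Erm] : exists rm, J = rm%:E.
  exists (fine J); rewrite fineK//.
  rewrite ge0_fin_numE; first by apply: le_lt_trans R2 _; exact: ltry.
  by apply: integral_ge0 => x _; rewrite lee_fin; exact: t0.
move: R1 R2; rewrite Erm !lee_fin => R1 R2.
(* Replacing (A - be)^s by A^s in the exact part costs A^s xi^(s-1) be, which lies between [lb * be]
   and [ub * be], just as [J] does. The two first-order terms therefore cancel up to (ub - lb) be,
   which is of second order in [be]. *)
have [xi /andP[x1 x1'] x2] := powR_increment s beA'.
have sn0 : s != 0 by rewrite gt_eqF.
have An0 : A != 0 by rewrite gt_eqF.
exists (rm - A `^ s * xi `^ (s - 1) * be); last first.
  rewrite -EFinD; congr (_%:E).
  have -> : (A - be) `^ s = A `^ s - s * xi `^ (s - 1) * be by rewrite -x2; ring.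
  have -> : 2 * s = s + s by ring.
  rewrite (@powRD _ A s s); last by rewrite An0 implybT.
  by field.
have [X1 X2] : lb <= A `^ s * xi `^ (s - 1) /\ A `^ s * xi `^ (s - 1) <= ub.
  rewrite /lb /ub; split.
    by rewrite ler_pM2l ?powR_gt0//; apply: powN; lra.
  by rewrite ler_pM ?powR_ge0//; [apply: powP; lra|apply: powN; lra].
have Aub : ub - lb <= 4 * be * A `^ (2 * s - 2) by exact: powR_sum_estimate.
have -> : 4 * be ^+ 2 * A `^ (2 * s - 2) = 4 * be * A `^ (2 * s - 2) * be by ring.
apply: le_trans (ler_wpM2r be0 Aub).
rewrite ler_norml; move: R1 R2 X1 X2 be0; clear; move: (A `^ s * xi `^ (s - 1)) => y.
move: lb ub => l u h1 h2 h3 h4 be0.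
have := ler_wpM2r be0 h3; have := ler_wpM2r be0 h4; rewrite mulrBl; lra.
Qed.

Lemma powR_integral (a A : R) : 0 < a -> 0 < A ->
  (\int[mu]_(w in `]0%R, A[) (w `^ (a - 1))%:E = (A `^ a / a)%:E)%E.
Proof.
move=> a0 A0.
apply: etrans; first apply: (@ge0_FTC2_oo R _ (fun w => tpow a w / a)).
- exact: A0.
- by move=> w _; exact: powR_ge0.
- by move=> w /andP[w0 _]; exact: continuous_powR.
- move=> w /andP[w0 _].
  have -> : (fun w => tpow a w / a) = a^-1 *: tpow a.
    by apply/funext => t; rewrite /GRing.scale/= mulrC.
  have -> : w `^ (a - 1) = a^-1 *: (a * w `^ (a - 1)).
    by rewrite /GRing.scale/= mulKf// gt_eqF.
  by apply: is_deriveZ; exact: is_derive_tpow.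
- by move=> w; apply: cvgM; [exact: continuous_tpow|exact: cvg_cst].
- by rewrite /= (tpow_le0 a0 (lexx 0)) mul0r subr0 tpowE// ltW.
Qed.

End truncated_power.

(** * The mean value formula on a line *)

Section mean_value_on_a_line.
Context {R : realType}.
Notation mu := (@lebesgue_measure R).

Definition beta_density (s v : R) : R := v `^ (s - 1) * (1 - v) `^ (- s).

(** Euler's beta integral B(s, 1 - s). *)
Definition beta_integral (s : R) : \bar R :=
  (\int[mu]_(v in `]0%R, 1%R[) (beta_density s v)%:E)%E.

Lemma beta_density_ge0 s v : 0 <= beta_density s v.
Proof. by rewrite mulr_ge0 ?powR_ge0. Qed.

Lemma measurable_onem_powR (a : R) (f : R -> R) : measurable_fun setT f ->
  measurable_fun setT (fun v => (1 - f v) `^ a).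
Proof.
move=> mf; apply: (measurableT_comp (measurable_powR a)).
exact: measurable_funB.
Qed.

Lemma measurable_beta_density s : measurable_fun setT (beta_density s).
Proof.
apply: measurable_funM; first exact: measurable_powR.
by apply: measurable_onem_powR; exact: measurable_id.
Qed.

(** On each half of ]0, 1[ one of the two factors is at most 2, so twice their sum dominates the
    density; that sum has an explicit continuous primitive. *)
Lemma beta_integral_lty (s : R) : 0 < s < 1 -> (beta_integral s < +oo)%E.
Proof.
move=> /andP[s0 s1].
pose g (v : R) := 2 * (v `^ (s - 1) + (1 - v) `^ (- s)).
have sn0 : s != 0 by rewrite gt_eqF.
have s1n0 : 1 - s != 0 by rewrite gt_eqF// subr_gt0.
have c1 (v : R) : 0 < v < 1 -> {for v, continuous (fun u : R => (1 - u) `^ (- s))}.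
  move=> v01; apply: (@continuous_comp _ _ _ (fun u : R => 1 - u) (fun u : R => u `^ (- s))).
    by apply: cvgB; [exact: cvg_cst|exact: cvg_id].
  apply: continuous_powR; lra.
apply: (@le_lt_trans _ _ (\int[mu]_(v in `]0%R, 1%R[) (g v)%:E)%E).
  apply: ge0_le_integral => //.
  - by move=> v _; rewrite lee_fin beta_density_ge0.
  - by apply/measurable_EFinP; apply: measurable_funTS; exact: measurable_beta_density.
  - apply/measurable_EFinP; apply: measurable_funTS; apply: measurable_funM => //.
    apply: measurable_funD; first exact: measurable_powR.
    by apply: measurable_onem_powR; exact: measurable_id.
  - move=> v /=; rewrite in_itv/= => /andP[v0 v1]; rewrite lee_fin /g /beta_density.
    have two (x a : R) : 1 / 2 <= x -> -1 <= a -> a <= 0 -> x <= 1 -> x `^ a <= 2.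
      move=> x2 a1 a0 x1; apply: (@le_trans _ _ (x `^ (-1))).
        by apply: ger_powR => //; lra.
      rewrite powR_inv1; last lra.
      rewrite invf_ple ?posrE; lra.
    have p1 := powR_ge0 v (s - 1); have p2 := powR_ge0 (1 - v) (- s).
    have [vh|vh] := leP (1 / 2) v.
      have : v `^ (s - 1) <= 2 by apply: two; lra.
      nra.
    have : (1 - v) `^ (- s) <= 2 by apply: two; lra.
    nra.
pose F v := 2 * (tpow s v / s - tpow (1 - s) (1 - v) / (1 - s)).
suff -> : (\int[mu]_(v in `]0%R, 1%R[) (g v)%:E = (F 1 - F 0)%:E)%E by exact: ltry.
apply: ge0_FTC2_oo => //.
- by move=> x _; rewrite /g mulr_ge0// addr_ge0 ?powR_ge0.
- move=> x x01; apply: cvgM; first exact: cvg_cst.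
  apply: cvgD; last exact: c1.
  apply: continuous_powR; lra.
- move=> x x01.
  have d1 : is_derive x 1 (tpow s) (s * x `^ (s - 1)) by apply: is_derive_tpow; lra.
  have d2 : is_derive x 1 (fun w => tpow (1 - s) (1 - w)) (-1 * ((1 - s) * (1 - x) `^ (1 - s - 1))).
    rewrite mulrC; apply: (@is_derive1_comp _ (tpow (1 - s)) (fun w => 1 - w)).
      by apply: is_derive_tpow; lra.
    by rewrite -[X in is_derive _ _ _ X]sub0r; exact: is_deriveB.
  have -> : F =
      (2 : R) *: (s^-1 *: tpow s - (1 - s)^-1 *: (fun w => tpow (1 - s) (1 - w))).
    apply/funext => v; rewrite /GRing.scale/=; congr (2 * _).
    by rewrite [_ / s]mulrC [_ / (1 - s)]mulrC.
  have -> : g x = 2 *: (s^-1 *: (s * x `^ (s - 1)) - (1 - s)^-1 *: (-1 * ((1 - s) * (1 - x) `^ (1 - s - 1)))).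
    rewrite /g /GRing.scale/= (_ : 1 - s - 1 = - s); last ring.
    by field; apply/andP; split.
  apply: is_deriveZ; apply: is_deriveB; exact: is_deriveZ.
- move=> x; apply: cvgM; first exact: cvg_cst.
  apply: cvgB; apply: cvgM; try exact: cvg_cst.
    exact: continuous_tpow.
  apply: (@continuous_comp _ _ _ (fun u : R => 1 - u) (tpow (1 - s))).
    by apply: cvgB; [exact: cvg_cst|exact: cvg_id].
  by apply: continuous_tpow; rewrite subr_gt0.
Qed.

(* With X(w) = w (w + c) / (1 - w^2), the two terms are X^s dw/w for the two
   positive branches w1, w2 over the same value X; as w1 w2 = X / (1 + X), the sum
   of the two logarithmic differentials does not depend on c.  Explicitly,
   w2 = (w1 + c) / (1 + c w1) and w1 w2 = v. *)
Lemma tpow_mean_value (s c : R) : 0 < s < 1 -> 0 <= c < 1 ->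
  (\int[mu]_(x in `]0%R, 1%R[)
    ((tpow s (x + c) + tpow s (x - c)) * (x `^ (s - 1) * (1 - x ^+ 2) `^ (- s)))%:E
   = beta_integral s)%E.
Proof.
move=> /andP[s0 s1] /andP[c0 c1].
pose h x := x `^ (s - 1) * (1 - x ^+ 2) `^ (- s).
pose f1 x := tpow s (x + c) * h x.
pose f2 x := tpow s (x - c) * h x.
pose m x := (x + c) / (1 + c * x).
pose dm x := (1 - c ^+ 2) / (1 + c * x) ^+ 2.
pose v x := x * (x + c) / (1 + c * x).
pose dv x := (2 * x + c + c * x ^+ 2) / (1 + c * x) ^+ 2.
have h0 (x : R) : 0 <= h x by rewrite mulr_ge0 ?powR_ge0.
have f10 (x : R) : 0 <= f1 x by rewrite mulr_ge0 ?tpow_ge0.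
have f20 (x : R) : 0 <= f2 x by rewrite mulr_ge0 ?tpow_ge0.
have mh : measurable_fun setT h.
  apply: measurable_funM; first exact: measurable_powR.
  by apply: measurable_onem_powR; exact: exprn_measurable.
have mf1 : measurable_fun setT f1.
  apply: measurable_funM => //.
  by apply: measurableT_comp; [exact: measurable_tpow|exact: measurable_funD].
have mf2 : measurable_fun setT f2.
  apply: measurable_funM => //.
  by apply: measurableT_comp; [exact: measurable_tpow|exact: measurable_funB].
have den (x : R) : 0 <= x -> 1 + c * x != 0.
  by move=> x0; rewrite gt_eqF//; nra.
have den0 (x : R) : 0 <= x -> 0 < 1 + c * x by move=> x0; nra.
have dden (x : R) : is_derive x 1 (fun u : R => 1 + c * u) c.
  rewrite -[X in is_derive _ _ _ X]add0r; apply: is_deriveD.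
  by rewrite -[X in is_derive _ _ _ X]mulr1; exact: (@is_deriveZ _ _ _ id).
have dVden (x : R) : 0 <= x -> is_derive x 1 (fun u : R => (1 + c * u)^-1) (- (1 + c * x) ^- 2 *: c).
  move=> x0; have [d1 d2] := dden x; split; first by apply: derivableV => //; exact: den.
  by rewrite deriveV ?d2//; exact: den.
have dxc (x : R) : is_derive x 1 (fun u : R => u + c) 1.
  by rewrite -[X in is_derive _ _ _ X]addr0; exact: is_deriveD.
have Dm (x : R) : 0 <= x <= 1 -> is_derive x 1 m (dm x).
  move=> /andP[x0 _]; have d := dVden x x0; have dd := den x x0.
  have -> : dm x = (x + c) *: (- (1 + c * x) ^- 2 *: c) + (1 + c * x)^-1 *: 1.
    by rewrite /dm /GRing.scale/=; field.
  exact: (@is_deriveM _ _ (fun u : R => u + c) (fun u : R => (1 + c * u)^-1)).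
have Dv (x : R) : 0 <= x <= 1 -> is_derive x 1 v (dv x).
  move=> /andP[x0 x1]; have dd := den x x0.
  have -> : v = (id : R -> R) * m by apply/funext => u; rewrite /v /m/= mulrA.
  have -> : dv x = x *: dm x + m x *: 1.
    by rewrite /dv /dm /m /GRing.scale/=; field.
  by apply: is_deriveM; apply: Dm; rewrite x0.
have cden (x : R) : {for x, continuous (fun u : R => 1 + c * u)}.
  by apply: differentiable_continuous; apply/derivable1_diffP; have [] := dden x.
have cden2 (x : R) : 0 <= x -> {for x, continuous (fun u : R => ((1 + c * u) ^+ 2)^-1)}.
  move=> x0; apply: cvgV; first by rewrite expf_neq0// den.
  by apply: (@continuous_comp _ _ _ (fun u : R => 1 + c * u) (fun u : R => u ^+ 2)) => //; exact: exprn_continuous.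
have cdm (x : R) : 0 <= x <= 1 -> {for x, continuous dm}.
  move=> /andP[x0 _]; apply: cvgM; first exact: cvg_cst.
  exact: cden2.
have cdv (x : R) : 0 <= x <= 1 -> {for x, continuous dv}.
  move=> /andP[x0 _]; apply: cvgM; last exact: cden2.
  apply: cvgD; last by apply: cvgM; [exact: cvg_cst|exact: exprn_continuous].
  by apply: cvgD; [apply: cvgM; [exact: cvg_cst|exact: cvg_id]|exact: cvg_cst].
have ch (x : R) : 0 < x < 1 -> {for x, continuous h}.
  move=> x01; apply: cvgM; first by apply: continuous_powR; lra.
  apply: (@continuous_comp _ _ _ (fun u : R => 1 - u ^+ 2) (fun u : R => u `^ (- s))).
    by apply: cvgB; [exact: cvg_cst|exact: exprn_continuous].
  apply: continuous_powR; nra.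
(* The second branch is 0 up to [c], and [m] maps ]0, 1[ increasingly onto the remaining interval
   ]c, 1[. *)
have E2 : (\int[mu]_(w in `]0%R, 1%R[) (f2 w)%:E =
    \int[mu]_(x in `]0%R, 1%R[) (f2 (m x) * dm x)%:E)%E.
  have -> : (\int[mu]_(w in `]0%R, 1%R[) (f2 w)%:E = \int[mu]_(w in `]c, 1%R[) (f2 w)%:E)%E.
    rewrite (@ge0_integral_itvoo_split _ f2 0 c 1)//; last by rewrite c0 ltW.
    rewrite [X in (X + _)%E]integral0_eq ?add0e// => x /=; rewrite in_itv/= => /andP[_ xc].
    by rewrite /f2 tpow_le0 ?mul0r// subr_le0 ltW.
  have := @ge0_substitution_oo R m dm f2 0 1 ltr01 Dm cdm.
  have -> : m 0 = c by rewrite /m add0r mulr0 addr0 divr1.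
  have -> : m 1 = 1 by rewrite /m mulr1 divff//; have := den 1 ler01; rewrite mulr1.
  apply.
  - by move=> x x01; rewrite divr_gt0 ?exprn_gt0 ?den0//; nra.
  - by move=> x _.
  - move=> x x01; apply: cvgM; last by apply: ch; lra.
    apply: (@continuous_comp _ _ _ (fun u : R => u - c) (tpow s)).
      by apply: cvgB; [exact: cvg_id|exact: cvg_cst].
    exact: continuous_tpow.
transitivity (\int[mu]_(w in `]0%R, 1%R[) (f1 w)%:E + \int[mu]_(w in `]0%R, 1%R[) (f2 w)%:E)%E.
  rewrite -ge0_integralD_fun//; [|exact: measurable_funTS|exact: measurable_funTS].
  by apply: eq_integral => x _; rewrite mulrDl.
have dm0 (x : R) : 0 <= x <= 1 -> 0 < dm x.
  by move=> /andP[x0 _]; rewrite divr_gt0 ?exprn_gt0 ?den0//; nra.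
have mf2m : measurable_fun (`]0, 1[ : set R) (EFin \o (fun x => f2 (m x) * dm x)).
  apply/measurable_EFinP; apply: measurable_fun_continuous_oo => x x01.
  have x01W : 0 <= x <= 1 by lra.
  apply: cvgM; last exact: cdm.
  have cm : {for x, continuous m}.
    by apply: differentiable_continuous; apply/derivable1_diffP; have [] := Dm x x01W.
  have m01 : 0 < m x < 1.
    have p := den0 x (ltW (proj1 (andP x01))).
    rewrite /m ltr_pdivrMr// mul1r divr_gt0//=; first by nra.
    by lra.
  apply: (@continuous_comp _ _ _ m f2) => //.
  apply: cvgM; last exact: ch.
  apply: (@continuous_comp _ _ _ (fun u : R => u - c) (tpow s)).
    by apply: cvgB; [exact: cvg_id|exact: cvg_cst].
  exact: continuous_tpow.
rewrite E2 -ge0_integralD//=; last 3 first.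
- by move=> x _; rewrite lee_fin.
- by apply: measurable_funTS; exact/measurable_EFinP.
- by move=> x; rewrite in_itv/= => x01; rewrite lee_fin mulr_ge0// ltW// dm0; lra.
rewrite /beta_integral.
have := @ge0_substitution_oo R v dv (beta_density s) 0 1 ltr01 Dv cdv.
have -> : v 0 = 0 by rewrite /v !mul0r.
have -> : v 1 = 1 by rewrite /v mulr1 mul1r divff//; have := den 1 ler01; rewrite mulr1.
move=> S; apply: etrans; last (apply: esym; apply: S); last 3 first.
- move=> x /andP[x0 x1]; rewrite divr_gt0 ?exprn_gt0 ?den0//; last lra.
  have := mulr_ge0 c0 (sqr_ge0 x); lra.
- by move=> x _; exact: beta_density_ge0.
- move=> x x01; apply: cvgM; first by apply: continuous_powR; lra.
  apply: (@continuous_comp _ _ _ (fun u : R => 1 - u) (fun u : R => u `^ (- s))).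
    by apply: cvgB; [exact: cvg_cst|exact: cvg_id].
  apply: continuous_powR; lra.
apply: eq_integral => x; rewrite inE/= in_itv/= => /andP[x0 x1].
rewrite -EFinD; congr (_%:E).
have D0 := den0 x (ltW x0); have Dn0 := den x (ltW x0).
have xc0 : 0 < x + c by lra.
have c2 : 0 < 1 - c ^+ 2 by nra.
have x2 : 0 < 1 - x ^+ 2 by nra.
rewrite /f1 /f2 /h /beta_density tpowE ?(ltW xc0)//.
(* By these factorizations every base of a power is a product or quotient of x, x + c, 1 + c x, 1 -
   c^2 and 1 - x^2. Once the powers are split, the claim is an identity of rational functions in
   these quantities and their s-th powers. *)
have Em : m x - c = x * (1 - c ^+ 2) / (1 + c * x) by rewrite /m; field.
have Em2 : 1 - m x ^+ 2 = (1 - c ^+ 2) * (1 - x ^+ 2) / (1 + c * x) ^+ 2 by rewrite /m; field.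
have Ev : 1 - v x = (1 - x ^+ 2) / (1 + c * x) by rewrite /v; field.
rewrite Em Em2 Ev /v /m tpowE; last by rewrite !divr_ge0 ?mulr_ge0 ?ltW.
have PX (a : R) : x `^ (a - 1) = x `^ a / x.
  by rewrite powRB ?powRr1 ?(ltW x0)//; apply/implyP => _; rewrite gt_eqF.
have PC (a : R) : (x + c) `^ (a - 1) = (x + c) `^ a / (x + c).
  by rewrite powRB ?powRr1 ?(ltW xc0)//; apply/implyP => _; rewrite gt_eqF.
have PD (a : R) : (1 + c * x)^-1 `^ a = ((1 + c * x) `^ a)^-1.
  by rewrite -powR_inv1 ?(ltW D0)// -powRrM mulN1r powRN.
have PD2 (a : R) : ((1 + c * x) ^+ 2)^-1 `^ a = ((1 + c * x) `^ a)^-1 ^+ 2.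
  by rewrite -exprVn expr2 powRM ?invr_ge0 ?(ltW D0)// PD -expr2.
have D0' : 0 <= (1 + c * x)^-1 by rewrite invr_ge0 ltW.
have D0'' : 0 <= ((1 + c * x) ^+ 2)^-1 by rewrite invr_ge0 exprn_ge0// ltW.
have PDs : (1 + c * x) `^ (s - 1) = (1 + c * x) `^ s / (1 + c * x).
  by rewrite powRB ?powRr1 ?(ltW D0)//; apply/implyP => _; rewrite gt_eqF.
rewrite !powRM ?mulr_ge0 ?(ltW x0) ?(ltW xc0) ?(ltW c2) ?(ltW x2)//.
rewrite !PD !PD2 !powRN PDs PX PC /dm /dv.
have g1 : x `^ s != 0 by rewrite gt_eqF// powR_gt0.
have g2 : (x + c) `^ s != 0 by rewrite gt_eqF// powR_gt0.
have g3 : (1 + c * x) `^ s != 0 by rewrite gt_eqF// powR_gt0.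
have g4 : (1 - c ^+ 2) `^ s != 0 by rewrite gt_eqF// powR_gt0.
have g5 : (1 - x ^+ 2) `^ s != 0 by rewrite gt_eqF// powR_gt0.
have xn0 : x != 0 by rewrite gt_eqF.
have xcn0 : x + c != 0 by rewrite gt_eqF.
move: (x `^ s) ((x + c) `^ s) ((1 + c * x) `^ s) ((1 - c ^+ 2) `^ s) ((1 - x ^+ 2) `^ s) g1 g2 g3 g4 g5.
move=> p1 p2 p3 p4 p5 g1 g2 g3 g4 g5.
by field; rewrite ?g1 ?g2 ?g3 ?g4 ?g5 ?xn0 ?xcn0 ?Dn0.
Qed.

End mean_value_on_a_line.
(** * Integration over R^n *)

Section integral_density.
Local Open Scope ereal_scope.
Context d (T : measurableType d) (R : realType).
Variables mu nu : {measure set T -> \bar R}.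
Variable k : T -> R.
Hypotheses (mk : measurable_fun setT k) (k0 : forall x, (0 <= k x)%R).
Hypothesis nuE : forall A, measurable A -> nu A = \int[mu]_(x in A) (k x)%:E.

Import HBNNSimple.

(** For simple functions the claim is [nuE] on the level sets; monotone convergence on both sides
    does the rest. *)
Lemma ge0_integral_density (f : T -> R) : measurable_fun setT f ->
  (forall x, (0 <= f x)%R) ->
  \int[nu]_x (f x)%:E = \int[mu]_x (f x * k x)%:E.
Proof.
move=> mf f0; have mf' : measurable_fun setT (EFin \o f) by exact/measurable_EFinP.
have f0' x : setT x -> 0 <= (EFin \o f) x by move=> _; rewrite lee_fin.
pose h := nnsfun_approx measurableT mf'.
have cvh x : (EFin \o h n) x @[n --> \oo] --> (f x)%:E.
  by have := @cvg_nnsfun_approx _ _ _ _ measurableT _ mf' f0' x I.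
transitivity (lim (\int[nu]_x (EFin \o h n) x @[n --> \oo])).
  rewrite -monotone_convergence//.
  - by apply: eq_integral => x _; apply/esym/cvg_lim => //; exact: cvh.
  - by move=> n; apply/measurable_EFinP.
  - by move=> n x _ /=; rewrite lee_fin.
  - by move=> x _ a b ab; rewrite lee_fin; exact/lefP/nd_nnsfun_approx.
transitivity (lim (\int[mu]_x (h n x * k x)%:E @[n --> \oo])); last first.
  rewrite -monotone_convergence//.
  - apply: eq_integral => x _; apply/cvg_lim => //.
    under eq_fun do rewrite EFinM.
    by rewrite EFinM; apply: cvgeZr => //; exact: cvh.
  - by move=> n; apply/measurable_EFinP; exact: measurable_funM.
  - by move=> n x _ /=; rewrite lee_fin mulr_ge0.
  - move=> x _ a b ab; rewrite lee_fin ler_wpM2r//.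
    exact/lefP/nd_nnsfun_approx.
congr (limn _); apply/funext => n.
have mh r : measurable (h n @^-1` [set r]).
  by rewrite -[X in measurable X]setTI; exact: measurable_funP.
transitivity (\int[nu]_x (\sum_(y \in range (h n)) (y * \1_(h n @^-1` [set y]) x)%:E)).
  by apply: eq_integral => t _; rewrite /= fimfunE -fsumEFin.
rewrite ge0_integral_fsum//; last 2 first.
- by move=> r; apply/measurable_EFinP; exact: measurable_funM.
- by move=> r x _; exact: nnfun_muleindic_ge0.
transitivity (\int[mu]_x (\sum_(y \in range (h n)) (y * \1_(h n @^-1` [set y]) x)%:E * (k x)%:E)).
  rewrite ge0_integral_fsum//; last 2 first.
  - move=> r; apply/measurable_EFinP; apply: measurable_funM => //.
    exact: measurable_funM.
  - by move=> r x _; rewrite mule_ge0 ?lee_fin// -lee_fin nnfun_muleindic_ge0.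
  apply: eq_fsbigr => r rhn.
  have [r0|r0] := leP 0%R r; last first.
    rewrite !integral0_eq// => x _; rewrite ?preimage_nnfun0// indicE in_set0 mulr0//.
    by rewrite mul0e.
  under eq_integral do rewrite EFinM.
  rewrite ge0_integralZl//; try by [apply/measurable_EFinP].
  under [RHS]eq_integral do rewrite EFinM -muleA.
  rewrite ge0_integralZl//; try by [apply/measurable_EFinP; exact: measurable_funM|move=> x _; rewrite lee_fin mulr_ge0].
  congr (_ * _); rewrite integral_indic// setIT nuE// integral_mkcond.
  by apply: eq_integral => x _; rewrite /= epatch_indic muleC.
apply: eq_integral => x _.
rewrite -ge0_mule_fsuml => [|y]; last exact: nnfun_muleindic_ge0.
by rewrite fsumEFin// -(fimfunE _ x).
Qed.

End integral_density.

(** * Scaling of the Lebesgue measure on the line *)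

Section lebesgue_scaling.
Local Open Scope ereal_scope.
Context {R : realType}.
Notation mu := (@lebesgue_measure R).

Lemma measurable_fun_invr : measurable_fun setT (fun x : R => x^-1)%R.
Proof.
have -> : [set: R] = [set 0%R] `|` [set~ 0%R] by rewrite setUv.
apply/measurable_funU => //; first exact: measurableC.
split; first exact: measurable_fun_set1.
apply: open_continuous_measurable_fun.
  by apply: closed_openC; exact: closed_eq.
by move=> x; rewrite inE/= => /eqP x0; exact: inv_continuous.
Qed.

(** By uniqueness of the Lebesgue measure it is enough to compare on the intervals ]a, b]. A
    negative [k] only exchanges the open and the closed end; this case is kept because [k = -1]
    gives the reflection y |-> - y. *)
Lemma lebesgue_measure_scale (k : R) (A : set R) : (k != 0)%R -> measurable A ->
  mu A = (`|k|)%:E * mu (( *%R k) @^-1` A).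
Proof.
move=> k0; have mk : measurable_fun setT ( *%R k) by exact: measurable_funM.
pose nu (B : set R) := mscale (NngNum (normr_ge0 k)) (pushforward mu ( *%R k : R -> measurableTypeR R)) B.
move=> mA; transitivity (nu mk A); last by [].
apply: lebesgue_measure_unique => // _ [[a b]] _ <-.
rewrite /nu/= /mscale/= /pushforward.
have [kp|kn|k0'] := ltgtP 0%R k; last by rewrite -k0' eqxx in k0.
  have -> : ( *%R k) @^-1` `]a, b] = [set` `](a / k)%R, (b / k)%R]].
    apply/seteqP; split => x /=; rewrite !in_itv/= ltr_pdivrMr// ler_pdivlMr//.
      by rewrite mulrC.
    by rewrite [(k * x)%R]mulrC.
  rewrite !lebesgue_measure_itv/= !lte_fin ltr_pM2r ?invr_gt0//.
  case: ifPn => _; last by rewrite mule0.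
  rewrite -!EFinD -EFinM -mulrBl gtr0_norm// mulrC divfK//.
have -> : ( *%R k) @^-1` `]a, b] = [set` `[(b / k)%R, (a / k)%R[].
  apply/seteqP; split => x /=; rewrite !in_itv/= ltr_ndivlMr// ler_ndivrMr//.
    by rewrite mulrC => /andP[-> ->].
  by rewrite [(k * x)%R]mulrC => /andP[-> ->].
rewrite !lebesgue_measure_itv/= !lte_fin ltr_nM2r ?invr_lt0//.
case: ifPn => _; last by rewrite mule0.
by rewrite -!EFinD -EFinM ltr0_norm//; congr (_%:E); field; rewrite lt_eqF.
Qed.

Lemma ge0_integral_lebesgue_scale (k : R) (f : R -> \bar R) : (k != 0)%R ->
  measurable_fun setT f -> (forall x, 0 <= f x) ->
  \int[mu]_x f (k * x)%R = (`|k|^-1)%:E * \int[mu]_x f x.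
Proof.
move=> k0 mf f0; have mk : measurable_fun setT ( *%R k) by exact: measurable_funM.
have kk : (`|k|^-1 * `|k| = 1)%R by rewrite mulVf// normr_eq0.
rewrite -[LHS]mul1e -kk EFinM -muleA; congr (_ * _).
transitivity ((NngNum (normr_ge0 k))%:num%:E *
    \int[pushforward mu ( *%R k : R -> measurableTypeR R)]_x f x).
  by rewrite ge0_integral_pushforward// preimage_setT.
rewrite -ge0_integral_mscale//.
by apply: eq_measure_integral => A mA _; exact/esym/lebesgue_measure_scale.
Qed.

End lebesgue_scaling.

(** * Volume of cubes, Tonelli and polar coordinates in R^n *)

Section lebesgue_rV_theory.
Local Open Scope ereal_scope.
Context {R : realType}.
Notation mu := (@lebesgue_measure R).
Notation leb n := (lebesgue_rV R n).

Lemma rV_consEl n (y : 'rV[R]_n) (a : R) (i : 'I_1) :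
  rV_cons (y, a) ord0 (lshift n i) = a.
Proof. by rewrite /rV_cons/= (@row_mxEl _ 1 1 n) mxE (ord1 i). Qed.

Lemma rV_consEr n (y : 'rV[R]_n) (a : R) (i : 'I_n) :
  rV_cons (y, a) ord0 (rshift 1 i) = y ord0 i.
Proof. by rewrite /rV_cons/= (@row_mxEr _ 1 1 n). Qed.

(** An open ball of the sup norm, written in coordinates: as a product of intervals it has a volume
    that is computed by induction on [n]. *)
Definition rbox n (c : 'rV[R]_n) (d : R) : set 'rV[R]_n :=
  [set x | forall i, (`|x ord0 i - c ord0 i| < d)%R].

Lemma measurable_rbox n (c : 'rV[R]_n) d : measurable (rbox c d).
Proof.
have -> : rbox c d = \bigcap_(i in [set: 'I_n]) [set x : 'rV[R]_n | (`|x ord0 i - c ord0 i| < d)%R].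
  by apply/seteqP; split => [x H i _|x H i]; [exact: H|exact: (H i I)].
apply: fin_bigcap_measurable; first exact: finite_finset.
move=> i _.
have m : measurable_fun setT (fun x : 'rV[R]_n => `|x ord0 i - c ord0 i|%R).
  apply: measurableT_comp => //; apply: measurable_funB => //.
  exact: measurable_coord.
have := m measurableT `]-oo, d[%classic (measurable_itv _).
by rewrite setTI; congr (measurable _); apply/seteqP; split => x /=; rewrite in_itv.
Qed.

Lemma lebesgue_rV_rbox n (c : 'rV[R]_n) (d : R) : (0 < d)%R ->
  leb n (rbox c d) = ((2 * d) ^+ n)%:E.
Proof.
move=> d0; elim: n c => [|n IH] c.
  by rewrite /= diracE mem_set// => -[].
rewrite [LHS]/= /lebesgue_rVS /pushforward.
pose c' : 'rV[R]_n := \row_i c ord0 (rshift 1 i).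
pose c0 := c ord0 (@lshift 1 n ord0).
have -> : @rV_cons R n @^-1` (rbox c d) = rbox c' d `*` `](c0 - d)%R, (c0 + d)%R[.
  apply/seteqP; split => -[y a] /=.
    move=> H; split.
      by move=> i; have := H (rshift 1 i); rewrite rV_consEr /c' mxE.
    by have := H (@lshift 1 n ord0); rewrite rV_consEl -/c0 in_itv/= ltr_distl.
  move=> [H1 H2] i; case: (@split_ordP 1 n i) => j ->.
    by rewrite rV_consEl (ord1 j) -/c0 ltr_distl; move: H2; rewrite in_itv.
  by rewrite rV_consEr; have := H1 j; rewrite /c' mxE.
transitivity (leb n (rbox c' d) * mu `](c0 - d)%R, (c0 + d)%R[).
  by apply: product_measure1E; [exact: measurable_rbox|exact: measurable_itv].
rewrite IH lebesgue_measure_itv/= lte_fin ltrD2l gtrN// -EFinD -EFinM exprSr.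
by congr (_%:E); ring.
Qed.

Lemma sigma_finite_lebesgue_rV n : sigma_finite setT (leb n).
Proof.
exists (fun k => rbox 0 k.+1%:R).
  apply/esym/seteqP; split=> x _ //.
  have [k kP] : exists k : nat, forall i, (`|x ord0 i| < k.+1%:R)%R.
    exists (Num.truncn (\sum_i `|x ord0 i|)%R) => i.
    apply: le_lt_trans (truncnS_gt _).
    by rewrite (bigD1 i)//= lerDl sumr_ge0.
  by exists k => // i; rewrite mxE subr0.
move=> k; split; first exact: measurable_rbox.
by rewrite lebesgue_rV_rbox// ltry.
Qed.

(* [lebesgue_rV R n] with its sigma-finite structure, for Tonelli's theorem. *)
Definition lebesgue_rV_sf n : set 'rV[R]_n -> \bar R := leb n.

HB.instance Definition _ n := isMeasure.Build _ _ _ (@lebesgue_rV_sf n)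
  (measure0 (leb n)) (measure_ge0 (leb n)) (@measure_semi_sigma_additive _ _ _ (leb n)).

HB.instance Definition _ n := @Measure_isSigmaFinite.Build _ _ _ (@lebesgue_rV_sf n)
  (@sigma_finite_lebesgue_rV n).

Lemma ge0_integral_rVS n (f : 'rV[R]_n.+1 -> \bar R) : measurable_fun setT f ->
  (forall x, 0 <= f x) ->
  \int[leb n.+1]_x f x = \int[leb n]_y \int[mu]_a f (rV_cons (y, a)).
Proof.
move=> mf f0; rewrite [leb n.+1]/= /lebesgue_rVS.
rewrite ge0_integral_pushforward//; last exact: measurable_rV_cons.
rewrite preimage_setT.
rewrite (@fubini_tonelli1 _ _ _ _ _ (@lebesgue_rV_sf n) mu (f \o @rV_cons R n))//; last first.
  by move=> p; exact: f0.
by apply: measurableT_comp => //; exact: measurable_rV_cons.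
Qed.

Lemma rV_consZ n (k a : R) (y : 'rV[R]_n) :
  k *: rV_cons (y, a) = rV_cons (k *: y, (k * a)%R) :> 'rV_n.+1.
Proof.
apply/rowP => i; case: (@split_ordP 1 n i) => j ->.
  by rewrite mxE (ord1 j) !rV_consEl.
by rewrite mxE !rV_consEr mxE.
Qed.

Lemma measurable_fun_scale n (k : R) : measurable_fun setT (fun x : 'rV[R]_n => k *: x).
Proof.
apply: measurable_fun_coordP => i; under eq_fun do rewrite mxE.
by apply: measurable_funM => //; exact: measurable_coord.
Qed.

Lemma ge0_integral_rV_scale n (k : R) (f : 'rV[R]_n -> \bar R) : (k != 0)%R ->
  measurable_fun setT f -> (forall x, 0 <= f x) ->
  \int[leb n]_x f (k *: x) = ((`|k| ^- n)%R)%:E * \int[leb n]_x f x.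
Proof.
move=> k0; elim: n f => [|n IH] f mf f0.
  rewrite /= !integral_dirac//=; last exact: (measurableT_comp mf (@measurable_fun_scale 0 k)).
  by rewrite !diracT !mul1e scaler0 invr1 mul1e.
have mcons : measurable_fun setT (f \o @rV_cons R n).
  by apply: measurableT_comp => //; exact: measurable_rV_cons.
have mG : measurable_fun setT (fun y => \int[mu]_a f (rV_cons (y, a))).
  have := @measurable_fun_fubini_tonelli_F _ _ _ _ _ mu (f \o @rV_cons R n) mcons (fun p => f0 _).
  exact.
rewrite !ge0_integral_rVS//; last by apply: measurableT_comp => //; exact: measurable_fun_scale.
have my y : measurable_fun setT (fun a => f (rV_cons (y, a))).
  exact: (measurableT_comp mcons (pair1_measurable y)).
under eq_integral => y _.
  under eq_integral do rewrite rV_consZ.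
  rewrite (@ge0_integral_lebesgue_scale _ k (fun a => f (rV_cons (k *: y, a))))//.
  over.
have mGk : measurable_fun setT (fun y : 'rV[R]_n => \int[mu]_a f (rV_cons (k *: y, a))).
  by apply: (measurableT_comp mG); exact: measurable_fun_scale.
have G0 y : 0 <= \int[mu]_a f (rV_cons (k *: y, a)) by exact: integral_ge0.
rewrite ge0_integralZl; [|exact: measurableT|exact: mGk|by move=> y _; exact: G0|by rewrite lee_fin invr_ge0].
rewrite (IH (fun y => \int[mu]_a f (rV_cons (y, a))))//; last first.
  by move=> y; apply: integral_ge0.
by rewrite muleA -EFinM exprS invfM.
Qed.

Lemma enormZ n (k : R) (x : 'rV[R]_n) : enorm (k *: x) = (`|k| * enorm x)%R.
Proof.
rewrite /enorm -sqrtr_sqr -sqrtrM ?sqr_ge0//; congr (Num.sqrt _).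
by rewrite mulr_sumr; apply: eq_bigr => i _; rewrite mxE exprMn.
Qed.

Lemma enorm_ge0 n (x : 'rV[R]_n) : (0 <= enorm x)%R.
Proof. exact: sqrtr_ge0. Qed.

Lemma enorm0 n : enorm (0 : 'rV[R]_n) = 0%R.
Proof.
by rewrite /enorm big1 ?sqrtr0// => i _; rewrite mxE expr0n.
Qed.

Lemma ler_coord_enorm n (x : 'rV[R]_n) i : (`|x ord0 i| <= enorm x)%R.
Proof.
rewrite -sqrtr_sqr /enorm ler_sqrt ?sumr_ge0// => [|j _]; last exact: sqr_ge0.
by rewrite (bigD1 i)//= lerDl sumr_ge0// => j _; exact: sqr_ge0.
Qed.

Lemma enorm_eq0 n (x : 'rV[R]_n) : enorm x = 0%R -> x = 0%R.
Proof.
move=> x0; apply/rowP => i; rewrite mxE; apply/eqP; rewrite -normr_le0 -x0.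
exact: ler_coord_enorm.
Qed.

Definition annulus_weight n (v : 'rV[R]_n) : R :=
  if (1 <= enorm v < 2)%R then enorm v else 0%R.

Lemma annulus_weight_ge0 n (v : 'rV[R]_n) : (0 <= annulus_weight v)%R.
Proof. by rewrite /annulus_weight; case: ifP => // _; exact: enorm_ge0. Qed.

Lemma measurable_annulus_weight n : measurable_fun setT (@annulus_weight n).
Proof.
apply: measurable_fun_ifT => //; last exact: measurable_enorm.
apply: (@measurable_and _ _ setT (fun v => 1 <= enorm v)%R (fun v => enorm v < 2)%R).
  by apply: measurable_fun_ler => //; exact: measurable_enorm.
by apply: measurable_fun_ltr => //; exact: measurable_enorm.
Qed.

Lemma annulus_weight_integral n : \int[leb n]_v (annulus_weight v)%:E < +oo.
Proof.
have mb : measurable_fun setT (EFin \o (\1_(rbox 0 2) : 'rV[R]_n -> R)).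
  by apply/measurable_EFinP/measurable_indic; exact: measurable_rbox.
apply: (@le_lt_trans _ _ (\int[leb n]_v (2%:E * (\1_(rbox 0 2) v)%:E))).
  apply: ge0_le_integral => //.
  - by move=> v _; rewrite lee_fin annulus_weight_ge0.
  - by apply/measurable_EFinP; exact: measurable_annulus_weight.
  - exact: (measurable_funeM 2%:E).
  - move=> v _; rewrite -EFinM lee_fin /annulus_weight.
    case: ifPn => [/andP[_ v2]|_]; last by rewrite mulr_ge0.
    rewrite indicE mem_set ?mulr1 ?ltW// => i; rewrite mxE subr0.
    exact: le_lt_trans (ler_coord_enorm _ _) v2.
rewrite ge0_integralZl//.
rewrite integral_indic//; last exact: measurable_rbox.
by rewrite setIT lebesgue_rV_rbox// -EFinM ltry.
Qed.

Lemma measurable_fun_ray n : measurable_fun setT (fun p : 'rV[R]_n * R => p.2^-1 *: p.1).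
Proof.
apply: measurable_fun_coordP => i; under eq_fun do rewrite mxE.
apply: measurable_funM.
  by apply: (measurableT_comp measurable_fun_invr); exact: measurable_snd.
by apply: (measurableT_comp (measurable_coord i)); exact: measurable_fst.
Qed.

(* Polar coordinates without a surface measure: directions are spread over the
   annulus 1 <= |v| < 2, where (after w |-> 1/w along the rays) the weight |v|
   makes the total mass over a point y equal to |y| * length [1/|y|, 2/|y|[ = 1. *)
Lemma ge0_integral_polar n (f : 'rV[R]_n -> R) : measurable_fun setT f ->
  (forall x, (0 <= f x)%R) -> f 0%R = 0%R ->
  \int[leb n]_x (f x)%:E = \int[leb n]_v ((annulus_weight v)%:E *
     \int[mu]_(w in `]0%R, +oo[) (f (w^-1 *: v) * w ^- n.+1)%:E).
Proof.
move=> mf f0 f00.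
pose h (p : 'rV[R]_n * R) : R := ((if 0 < p.2 then p.2 ^- n.+1 else 0) *
   (annulus_weight p.1 * f (p.2^-1 *: p.1)))%R.
have h0 p : (0 <= h p)%R.
  rewrite mulr_ge0// ?mulr_ge0 ?annulus_weight_ge0//.
  by case: ifPn => // p0; rewrite invr_ge0 exprn_ge0// ltW.
have mpos : measurable_fun setT (fun w : R => if 0 < w then w ^- n.+1 else 0)%R.
  apply: measurable_fun_ifT => //.
    by apply: measurable_fun_ltr => //; exact: measurable_id.
  by apply: (measurableT_comp measurable_fun_invr); exact: exprn_measurable.
have mh : measurable_fun setT h.
  apply: measurable_funM.
    by apply: (measurableT_comp mpos); exact: measurable_snd.
  apply: measurable_funM.
    by apply: (measurableT_comp (@measurable_annulus_weight n)); exact: measurable_fst.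
  by apply: (measurableT_comp mf); exact: measurable_fun_ray.
have mhE : measurable_fun setT (EFin \o h) by exact/measurable_EFinP.
have h0E p : 0 <= (EFin \o h) p by rewrite lee_fin.
have T := @fubini_tonelli _ _ _ _ _ (@lebesgue_rV_sf n) mu (EFin \o h) mhE h0E.
transitivity (\int[leb n]_v \int[mu]_w (h (v, w))%:E); last first.
  apply: eq_integral => v _; rewrite -ge0_integralZl//; last 3 first.
  - apply: measurable_funTS; apply/measurable_EFinP; apply: measurable_funM.
      apply: (measurableT_comp mf).
      exact: (measurableT_comp (@measurable_fun_ray n) (pair1_measurable v)).
    by apply: (measurableT_comp measurable_fun_invr); exact: exprn_measurable.
  - move=> w /=; rewrite in_itv/= andbT => w0.
    by rewrite lee_fin mulr_ge0// invr_ge0 exprn_ge0// ltW.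
  - by rewrite lee_fin annulus_weight_ge0.
  rewrite [RHS]integral_mkcond; apply: eq_integral => w _.
  rewrite patchE /h/=; case: ifPn => w0.
    by rewrite mem_set/= ?in_itv/= ?w0// -EFinM; congr (_%:E); ring.
  by rewrite memNset/= ?in_itv/= ?(negbTE w0)// mul0r.
apply: esym; rewrite [LHS]T.
(* For fixed [w] the substitution v = w y reduces w^-(n+1) to w^-1 and frees the argument of [f]
   from [w], so that after a second exchange [w] is integrated against the weight alone. *)
transitivity (\int[mu]_w \int[leb n]_y
   ((if 0 < w then w^-1 * annulus_weight (w *: y) else 0) * f y)%:E).
  apply: eq_integral => w _; rewrite /h/=.
  case: ifPn => w0; last first.
    by under eq_integral do rewrite mul0r; under [RHS]eq_integral do rewrite mul0r.
  have wn0 : w != 0%R by rewrite gt_eqF.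
  pose g y := (w ^- n.+1 * (annulus_weight y * f (w^-1 *: y)))%R.
  have mg : measurable_fun setT (EFin \o g).
    apply/measurable_EFinP; apply: measurable_funM => //; apply: measurable_funM.
      exact: measurable_annulus_weight.
    by apply: (measurableT_comp mf); exact: measurable_fun_scale.
  have g0 y : 0 <= (EFin \o g) y.
    rewrite /= lee_fin /g; apply: mulr_ge0; last by rewrite mulr_ge0// annulus_weight_ge0.
    by rewrite invr_ge0 exprn_ge0// ltW.
  have := @ge0_integral_rV_scale n w (EFin \o g) wn0 mg g0.
  rewrite gtr0_norm// => E.
  transitivity (((w ^+ n)%R)%:E * \int[leb n]_y (EFin \o g) (w *: y)).
    by rewrite E muleA -EFinM divff ?mul1e// expf_neq0.
  rewrite -ge0_integralZl//; last 2 first.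
  - by apply: (measurableT_comp mg); exact: measurable_fun_scale.
  - by rewrite lee_fin exprn_ge0// ltW.
  apply: eq_integral => y _; rewrite /g/= -EFinM scalerA mulVf// scale1r exprS.
  by congr (_%:E); field; rewrite wn0 expf_neq0.
pose q (p : 'rV[R]_n * R) : R :=
  ((if 0 < p.2 then p.2^-1 * annulus_weight (p.2 *: p.1) else 0) * f p.1)%R.
have q0 p : 0 <= (EFin \o q) p.
  rewrite lee_fin mulr_ge0//; case: ifPn => // p0.
  by rewrite mulr_ge0 ?annulus_weight_ge0// invr_ge0 ltW.
have mq : measurable_fun setT (EFin \o q).
  apply/measurable_EFinP; apply: measurable_funM.
    apply: measurable_fun_ifT => //.
      by apply: measurable_fun_ltr => //; exact: measurable_snd.
    apply: measurable_funM.
      by apply: (measurableT_comp measurable_fun_invr); exact: measurable_snd.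
    apply: (measurableT_comp (@measurable_annulus_weight n)).
    apply: measurable_fun_coordP => i; under eq_fun do rewrite mxE.
    apply: measurable_funM; first exact: measurable_snd.
    by apply: (measurableT_comp (measurable_coord i)); exact: measurable_fst.
  by apply: (measurableT_comp mf); exact: measurable_fst.
rewrite -[LHS](@fubini_tonelli _ _ _ _ _ (@lebesgue_rV_sf n) mu (EFin \o q) mq q0).
apply: eq_integral => y _.
(* No ray reaches the origin, which for [n = 0] carries the whole mass; here [f 0 = 0] enters. *)
have [y0|y0] := eqVneq (enorm y) 0%R.
  rewrite (enorm_eq0 y0) f00 integral0_eq// => w _.
  by rewrite /q/= f00 mulr0.
have yp : (0 < enorm y)%R by rewrite lt0r y0 enorm_ge0.
have yi : (0 < (enorm y)^-1)%R by rewrite invr_gt0.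
transitivity (\int[mu]_(w in `[(enorm y)^-1%R, (2 * (enorm y)^-1)%R[) (cst (enorm y * f y)%:E w)).
  rewrite [RHS]integral_mkcond; apply: eq_integral => w _; rewrite patchE /q/=.
  case: ifPn => w0.
    rewrite /annulus_weight enormZ gtr0_norm//.
    have -> : (1 <= w * enorm y < 2)%R = (w \in `[((enorm y)^-1)%R, (2 * (enorm y)^-1)%R[).
      by rewrite in_itv/= ltr_pdivlMr// -[X in (X <= w)%R]mul1r ler_pdivrMr.
    rewrite mem_setE; case: ifPn => wi; last by rewrite mulr0 mul0r.
    by rewrite mulKf// gt_eqF.
  rewrite memNset/= ?mul0r// in_itv/= => /andP[w1 _].
  by move: w0; rewrite (lt_le_trans _ w1).
rewrite integral_cst//= lebesgue_measure_itv/= lte_fin.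
rewrite ifT; last by rewrite ltr_pMl// ltr1n.
by rewrite -EFinD -EFinM; congr (_%:E); field.
Qed.

Lemma ge0_integral_itv_scale (k : R) (h : R -> R) : (0 < k)%R ->
  measurable_fun setT h -> (forall x, (0 < x)%R -> (0 <= h x)%R) ->
  \int[mu]_(w in `]0%R, k[) (h w)%:E = \int[mu]_(x in `]0%R, 1%R[) (k * h (k * x))%:E.
Proof.
move=> k0 mh h0.
pose g w : \bar R := ((EFin \o h) \_ `]0%R, k[) w.
have g0 w : 0 <= g w.
  rewrite /g patchE; case: ifPn => //; rewrite inE/= in_itv/= => /andP[w0 _].
  by rewrite lee_fin h0.
have mg : measurable_fun setT g.
  by apply/(measurable_restrictT _ _).1 => //; apply: measurable_funTS; exact/measurable_EFinP.
have := ge0_integral_lebesgue_scale (lt0r_neq0 k0) mg g0.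
rewrite gtr0_norm// => E.
rewrite integral_mkcond -/g.
transitivity (k%:E * \int[mu]_x g (k * x)%R).
  by rewrite E muleA -EFinM mulfV ?mul1e// gt_eqF.
rewrite -ge0_integralZl//; last 2 first.
- by apply: (measurableT_comp mg); exact: measurable_funM.
- by rewrite lee_fin ltW.
rewrite [RHS]integral_mkcond; apply: eq_integral => x _.
rewrite /g !patchE.
have -> : ((k * x)%R \in [set` `]0%R, k[]) = (x \in [set` `]0%R, 1%R[]).
  by rewrite !mem_setE !in_itv/= pmulr_rgt0// -{2}(mulr1 k) ltr_pM2l.
by case: ifPn => _; rewrite ?mule0// -EFinM.
Qed.

(** In the inverted radial variable the point at infinity sits at w = 0, and the complement of the
    ball is bounded by w <= |v| / r. *)
Lemma integral_setC_eball_polar n (G : 'rV[R]_n -> R) (r : R) : (0 < r)%R ->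
  measurable_fun setT G -> (forall x, (0 <= G x)%R) ->
  \int[leb n]_(y in ~` eball r) (G y)%:E = \int[leb n]_v ((annulus_weight v)%:E *
     \int[mu]_(w in `]0%R, (enorm v / r)%R[) (G (w^-1 *: v) * w ^- n.+1)%:E).
Proof.
move=> r0 mG G0.
pose f y := if (r <= enorm y)%R then G y else 0%R.
have mf : measurable_fun setT f.
  by apply: measurable_fun_ifT => //; apply: measurable_fun_ler => //; exact: measurable_enorm.
have f0 x : (0 <= f x)%R by rewrite /f; case: ifP.
have f00 : f 0%R = 0%R by rewrite /f enorm0 leNgt r0.
transitivity (\int[leb n]_y (f y)%:E).
  rewrite integral_mkcond; apply: eq_integral => y _; rewrite patchE /f.
  have [yr|yr] := leP r (enorm y).
    by rewrite mem_set// => /=; rewrite /eball/= ltNge yr.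
  by rewrite memNset// => /=; apply.
rewrite (ge0_integral_polar mf f0 f00); apply: eq_integral => v _.
have [v1|v1] := boolP (1 <= enorm v < 2)%R; last by rewrite /annulus_weight (negbTE v1) !mul0e.
congr (_ * _).
have mh : measurable_fun setT (fun w : R => G (w^-1 *: v) * w ^- n.+1)%R.
  apply: measurable_funM.
    apply: (measurableT_comp mG).
    exact: (measurableT_comp (@measurable_fun_ray n) (pair1_measurable v)).
  by apply: (measurableT_comp measurable_fun_invr); exact: exprn_measurable.
rewrite [RHS]integral_itv_bndo_bndc; last first.
  by apply: measurable_funTS; exact/measurable_EFinP.
rewrite [LHS]integral_mkcond [RHS]integral_mkcond; apply: eq_integral => w _.
rewrite !patchE !mem_setE !in_itv/= andbT; case: ifPn => w0 //=.
rewrite /f enormZ gtr0_norm ?invr_gt0//.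
have -> : (r <= w^-1 * enorm v)%R = (w <= enorm v / r)%R by rewrite ler_pdivlMl// ler_pdivlMr.
by case: ifPn; rewrite ?mul0r.
Qed.

(** The scaling w = (|v| / r) x gives every ray the same interval ]0, 1[, the one of
    [tpow_mean_value]. *)
Lemma integral_setC_eball_polar_unit n (G : 'rV[R]_n -> R) (r : R) : (0 < r)%R ->
  measurable_fun setT G -> (forall x, (0 <= G x)%R) ->
  \int[leb n]_(y in ~` eball r) (G y)%:E = \int[leb n]_v ((annulus_weight v)%:E *
     \int[mu]_(x in `]0%R, 1%R[) (G ((r / enorm v / x) *: v) *
        ((enorm v / r) ^- n * x ^- n.+1))%:E).
Proof.
move=> r0 mG G0; rewrite (integral_setC_eball_polar r0 mG G0).
apply: eq_integral => v _.
have [/andP[v1 _]|v1] := boolP (1 <= enorm v < 2)%R; last by rewrite /annulus_weight (negbTE v1) !mul0e.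
have v0 : (0 < enorm v)%R by exact: lt_le_trans v1.
have k0 : (0 < enorm v / r)%R by rewrite divr_gt0.
have mh : measurable_fun setT (fun w : R => G (w^-1 *: v) * w ^- n.+1)%R.
  apply: measurable_funM.
    apply: (measurableT_comp mG).
    exact: (measurableT_comp (@measurable_fun_ray n) (pair1_measurable v)).
  by apply: (measurableT_comp measurable_fun_invr); exact: exprn_measurable.
congr (_ * _); rewrite (ge0_integral_itv_scale k0 mh); last first.
  by move=> x x0; rewrite mulr_ge0// invr_ge0 exprn_ge0// ltW.
apply: eq_integral => x _; congr (_%:E).
have -> : (((enorm v / r * x)%R)^-1 = r / enorm v / x)%R by rewrite !invfM invrK [(_^-1 * r)%R]mulrC.
rewrite mulrCA; congr (_ * _)%R.
rewrite exprMn invfM mulrA; congr (_ * _)%R.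
by rewrite exprS invfM mulrA mulfV ?mul1r// gt_eqF.
Qed.

(** The sigma-algebra is generated by the coordinates and not by the open sets, so the point is
    countability: an open set is the union of the cubes with rational centre and radius 1 / (k + 1)
    that it contains. *)
Lemma measurable_open_rV n (A : set 'rV[R]_n) : open A -> measurable A.
Proof.
move=> oA.
pose q2 (p : 'rV[rat]_n * nat) := rbox (map_mx ratr p.1 : 'rV[R]_n) (p.2.+1%:R^-1).
have -> : A = \bigcup_(p in [set p | q2 p `<=` A]) q2 p.
  apply/seteqP; split => [x Ax|x [p] /= H]; last exact: H.
  have [e /= e0 eA] : exists2 e : R, (0 < e)%R & ball x e `<=` A.
    by have /nbhs_ballP := open_nbhs_nbhs (conj oA Ax).
  have [k ke] : exists k : nat, (k.+1%:R^-1 < e / 2)%R.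
    exists (Num.truncn (e / 2)^-1).
    by rewrite invf_plt ?posrE ?divr_gt0// truncnS_gt.
  have kp : (0 < k.+1%:R^-1 :> R)%R by rewrite invr_gt0.
  have itvp i : (x ord0 i - k.+1%:R^-1 < x ord0 i + k.+1%:R^-1)%R by rewrite ltrD2l gtrN.
  have H i : exists q : rat, (`|x ord0 i - ratr q| < k.+1%:R^-1)%R.
    have [q] := @rat_in_itvoo R (x ord0 i - k.+1%:R^-1)%R (x ord0 i + k.+1%:R^-1)%R (itvp i).
    by rewrite in_itv/= => qi; exists q; rewrite distrC ltr_distl.
  exists (\row_i sval (cid (H i)), k) => /=; last first.
    by move=> i; rewrite /= !mxE; case: cid.
  move=> y Hy; apply: eA; split => // j i /=; rewrite (ord1 j).
  have h1 := Hy i; rewrite /= !mxE in h1; case: cid h1 => q qP /= h1.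
  rewrite /ball/= (le_lt_trans (ler_distD (ratr q) _ _))//.
  by rewrite [ltRHS](splitr e) ltrD// (lt_trans _ ke)// distrC.
rewrite bigcup_mkcond; apply: countable_bigcupT_measurable.
  exact: countableP.
by move=> p; case: ifPn => // _; exact: measurable_rbox.
Qed.

End lebesgue_rV_theory.

(** * Harmonicity and mean value formula for ridge functions *)

Section truncated_power_harmonic.
Local Open Scope ereal_scope.
Context {R : realType} (n : nat) (i : 'I_n).
Notation mu := (@lebesgue_measure R).
Notation leb := (lebesgue_rV R n).
Implicit Types (s L sg : R) (x y v : 'rV[R]_n).

(* Each restriction of [ridge] to a line is an affine reparametrization of t_+^s
   (or constant, as for [sg = 0]). *)
Definition ridge s L sg x : R := tpow s (L + sg * x ord0 i)%R.

Lemma ridge_ge0 s L sg x : (0 <= ridge s L sg x)%R.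
Proof. exact: tpow_ge0. Qed.

Lemma measurable_ridge s L sg : measurable_fun setT (ridge s L sg).
Proof.
apply: (measurableT_comp (measurable_tpow s)); apply: measurable_funD => //.
by apply: measurable_funM => //; exact: measurable_coord.
Qed.

Lemma measurable_enorm_powR (a : R) : measurable_fun setT (fun x : 'rV[R]_n => enorm x `^ a)%R.
Proof. by apply: (measurableT_comp (measurable_powR a)); exact: measurable_enorm. Qed.

Lemma measurable_invr_fun d (T : measurableType d) (f : T -> R) : measurable_fun setT f ->
  measurable_fun setT (fun t => (f t)^-1)%R.
Proof. exact: (measurableT_comp measurable_fun_invr). Qed.

Lemma measurable_subrV x : measurable_fun setT (fun y : 'rV[R]_n => x - y)%R.
Proof.
apply: measurable_fun_coordP => j; under eq_fun do rewrite !mxE.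
by apply: measurable_funB => //; exact: measurable_coord.
Qed.

Lemma measurable_addrV x : measurable_fun setT (fun y : 'rV[R]_n => x + y)%R.
Proof.
apply: measurable_fun_coordP => j; under eq_fun do rewrite !mxE.
by apply: measurable_funD => //; exact: measurable_coord.
Qed.

Lemma integral_setC_eball_oppr (r : R) (G : 'rV[R]_n -> R) :
  measurable_fun setT G -> (forall x, (0 <= G x)%R) ->
  \int[leb]_(y in ~` eball r) (G (- y))%:E = \int[leb]_(y in ~` eball r) (G y)%:E.
Proof.
move=> mG G0.
have mB : measurable (~` eball r : set 'rV[R]_n) by apply: measurableC; exact: measurable_eball.
pose g y : \bar R := ((EFin \o G) \_ (~` eball r)) y.
have mg : measurable_fun setT g.
  by apply/(measurable_restrictT _ _).1 => //; apply: measurable_funTS; exact/measurable_EFinP.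
have g0 y : 0 <= g y by rewrite /g patchE; case: ifP => // _; rewrite lee_fin.
have N1 : (-1 != 0 :> R)%R by rewrite oppr_eq0 oner_eq0.
have := @ge0_integral_rV_scale R n (-1) g N1 mg g0.
rewrite normrN1 expr1n invr1 mul1e => E.
rewrite [RHS]integral_mkcond -/g -E [LHS]integral_mkcond; apply: eq_integral => y _.
rewrite /g !patchE scaleN1r.
have -> // : ((- y)%R \in ~` eball r) = (y \in ~` eball r).
by apply/idP/idP; rewrite !inE /eball/= -scaleN1r enormZ normrN1 mul1r.
Qed.

(** Homogeneity of t_+^s applied to l + b / w = (l / w) (w + b / l): along a ray in the inverted
    variable, a ridge function becomes a shifted truncated power. *)
Lemma tpow_ray s (l b w : R) : (0 < l)%R -> (0 < w)%R ->
  tpow s (l + b / w)%R = (l `^ s * w `^ (- s) * tpow s (w + b / l))%R.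
Proof.
move=> l0 w0; have -> : (l + b / w = l / w * (w + b / l))%R.
  by field; rewrite !gt_eqF.
rewrite tpowM ?divr_ge0 ?ltW// powRM ?invr_ge0 ?ltW//.
by rewrite -(powR_inv1 (ltW w0)) -powRrM mulN1r.
Qed.

(* The leading term on the right is the integral of 2 u(x) along the same ray. *)
Lemma ridge_ray_integral s L sg x v (eps : R) : (0 < s < 1)%R -> (`|sg| <= 1)%R ->
  (0 < L + sg * x ord0 i)%R -> (1 <= enorm v < 2)%R ->
  (0 < eps)%R -> (2 * eps <= L + sg * x ord0 i)%R ->
  exists2 e : R, (`|e| <= 16 * (L + sg * x ord0 i) `^ (s - 2) * eps `^ (2 - 2 * s))%R &
  \int[mu]_(w in `]0%R, (enorm v / eps)%R[)
    ((ridge s L sg (x - w^-1 *: v) + ridge s L sg (x + w^-1 *: v)) * w `^ (2 * s - 1))%:E =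
  ((L + sg * x ord0 i) `^ s * (enorm v / eps) `^ (2 * s) / s + e)%:E.
Proof.
move=> s01; have /andP[s0 s1] := s01; move=> sg1; set l := (L + sg * x ord0 i)%R.
move=> l0 /andP[v1 v2] e0 el.
have v0 : (0 < enorm v)%R by exact: lt_le_trans v1.
pose b : R := (`|sg * v ord0 i|)%R.
have b0 : (0 <= b)%R by rewrite normr_ge0.
have bv : (b <= enorm v)%R.
  apply: le_trans (ler_coord_enorm v i).
  by rewrite /b normrM -[leRHS]mul1r ler_wpM2r.
have A0 : (0 < enorm v / eps)%R by rewrite divr_gt0.
have be0 : (0 <= b / l)%R by rewrite divr_ge0// ltW.
have beA : (2 * (b / l) <= enorm v / eps)%R.
  rewrite mulrA ler_pdivrMr// mulrAC ler_pdivlMr//.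
  by rewrite [(2 * b)%R]mulrC -mulrA ler_pM// mulr_ge0// ltW.
have [e eb eE] := tpow_pair_integral s01 be0 A0 beA.
(* The constant 16: the shift b / l is at most 2 / l because |v| < 2, so four times its square is at
   most 16 / l^2. The bound |v| >= 1 removes |v| from the power of |v| / eps, whose exponent 2 s - 2
   is negative. *)
exists (l `^ s * e)%R.
  rewrite normrM ger0_norm ?powR_ge0//.
  apply: (le_trans (ler_wpM2l (powR_ge0 _ _) eb)).
  have E1 : (l `^ (s - 2) = l `^ s / l ^+ 2)%R.
    by rewrite gt0_powRB// -[(l `^ 2)%R]/(l `^ 2%:R)%R powR_mulrn// ltW.
  have E2 : ((enorm v / eps) `^ (2 * s - 2) <= eps `^ (2 - 2 * s))%R.
    rewrite -(opprB (2:R)%R) powRN powRM ?invr_ge0 ?(ltW v0) ?(ltW e0)//.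
    rewrite (gt0_powRV _ e0) invfM invrK -[leRHS]mul1r.
    rewrite ler_wpM2r ?powR_ge0// invf_le1 ?powR_gt0//.
    by apply: powR_ge1 => //; lra.
  rewrite E1.
  have -> : (16 * (l `^ s / l ^+ 2) * eps `^ (2 - 2 * s) =
     l `^ s * (4 * (2 / l) ^+ 2 * eps `^ (2 - 2 * s)))%R by field; rewrite gt_eqF.
  apply: ler_wpM2l; first exact: powR_ge0.
  apply: ler_pM => //; first by rewrite mulr_ge0// sqr_ge0.
    exact: powR_ge0.
  apply: ler_wpM2l => //; rewrite lerXn2r ?nnegrE ?divr_ge0 ?(ltW l0)//.
  by rewrite ler_wpM2r ?invr_ge0 ?(ltW l0)// (le_trans bv)// ltW.
rewrite -mulrA -mulrDr EFinM -eE -ge0_integralZl; first last.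
- by rewrite lee_fin powR_ge0.
- by move=> w _; rewrite lee_fin mulr_ge0 ?powR_ge0 ?addr_ge0 ?tpow_ge0.
- apply/measurable_EFinP; apply: measurable_funTS.
  under eq_fun do rewrite mulrDl.
  by apply: measurable_funD; exact: measurable_tpow_shift.
- exact: measurable_itv.
apply: eq_integral => w; rewrite inE/= in_itv/= => /andP[w0 _].
rewrite -EFinM; congr (_%:E).
rewrite /ridge !mxE !mulrDr !addrA -/l.
have -> : (l + sg * (- (w^-1 * v ord0 i)) = l + (- (sg * v ord0 i)) / w)%R by field; rewrite gt_eqF.
have -> : (l + sg * (w^-1 * v ord0 i) = l + (sg * v ord0 i) / w)%R by field; rewrite gt_eqF.
rewrite (tpow_ray s (- (sg * v ord0 i))%R l0 w0) (tpow_ray s (sg * v ord0 i)%R l0 w0).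
rewrite mulNr -mulrDr.
have -> : (w `^ (2 * s - 1) = w `^ s * w `^ (s - 1))%R.
  rewrite -gt0_powRD//.
  by congr (_ `^ _)%R; ring.
(* The pair does not see the sign of the shift, which may thus be taken nonnegative. *)
have -> : (tpow s (w - sg * v ord0 i / l) + tpow s (w + sg * v ord0 i / l) =
          tpow s (w + b / l) + tpow s (w - b / l))%R.
  rewrite /b; case: (ger0P (sg * v ord0 i)%R) => _; last by rewrite mulNr opprK.
  by rewrite addrC.
have wn : (w `^ s != 0)%R by rewrite gt_eqF// powR_gt0.
rewrite powRN; field; exact: wn.
Qed.

Definition frac_kernel s y : R := ((enorm y `^ (n%:R + 2 * s))^-1)%R.

Lemma frac_kernel_ge0 s y : (0 <= frac_kernel s y)%R.
Proof. by rewrite invr_ge0 powR_ge0. Qed.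

Lemma measurable_frac_kernel s : measurable_fun setT (frac_kernel s).
Proof. by apply: measurable_invr_fun; exact: measurable_enorm_powR. Qed.

(** The Jacobian w^-(n+1) cancels the dimension in the kernel: on each ray the weight is w^(2s-1)
    for every [n]. *)
Lemma frac_kernel_ray s v (w : R) : (0 < w)%R -> (0 < enorm v)%R ->
  (frac_kernel s (w^-1 *: v) * w ^- n.+1 = frac_kernel s v * w `^ (2 * s - 1))%R.
Proof.
move=> w0 v0; rewrite /frac_kernel enormZ gtr0_norm ?invr_gt0//.
rewrite powRM ?invr_ge0 ?ltW// (gt0_powRV _ w0).
have -> : (w `^ (n%:R + 2 * s) = w `^ (2 * s - 1) * w ^+ n.+1)%R.
  rewrite -powR_mulrn ?(ltW w0)// -gt0_powRD//.
  by congr (_ `^ _)%R; rewrite -natr1; ring.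
have wn : (w ^+ n.+1 != 0)%R by rewrite expf_neq0// gt_eqF.
have g1 : (enorm v `^ (n%:R + 2 * s) != 0)%R by rewrite gt_eqF// powR_gt0.
have g2 : (w `^ (2 * s - 1) != 0)%R by rewrite gt_eqF// powR_gt0.
by field; rewrite wn g1 g2.
Qed.

Definition ray_weight s v : R := (annulus_weight v * frac_kernel s v)%R.

Lemma ray_weight_ge0 s v : (0 <= ray_weight s v)%R.
Proof. by rewrite mulr_ge0 ?annulus_weight_ge0 ?frac_kernel_ge0. Qed.

Lemma measurable_ray_weight s : measurable_fun setT (ray_weight s).
Proof. by apply: measurable_funM; [exact: measurable_annulus_weight|exact: measurable_frac_kernel]. Qed.

Lemma ray_weight_lty s : (0 < s)%R -> \int[leb]_v (ray_weight s v)%:E < +oo.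
Proof.
move=> s0; apply: le_lt_trans (annulus_weight_integral n); apply: ge0_le_integral => //.
- by move=> v _; rewrite lee_fin ray_weight_ge0.
- by apply/measurable_EFinP; exact: measurable_ray_weight.
- by apply/measurable_EFinP; exact: measurable_annulus_weight.
move=> v _; rewrite lee_fin /ray_weight /annulus_weight; case: ifPn => [/andP[v1 _]|]; last by rewrite mul0r.
rewrite -[leRHS]mulr1 ler_wpM2l ?enorm_ge0// /frac_kernel invf_le1 ?powR_gt0 ?(lt_le_trans _ v1)//.
by apply: powR_ge1 => //; rewrite addr_ge0// mulr_ge0// ltW.
Qed.

Lemma frac_kernel_polar s (eps : R) (G : 'rV[R]_n -> R) : (0 < eps)%R ->
  measurable_fun setT G -> (forall x, (0 <= G x)%R) ->
  \int[leb]_(y in ~` eball eps) (G y * frac_kernel s y)%:E =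
  \int[leb]_v ((ray_weight s v)%:E *
    \int[mu]_(w in `]0%R, (enorm v / eps)%R[) (G (w^-1 *: v) * w `^ (2 * s - 1))%:E).
Proof.
move=> e0 mG G0.
rewrite (@integral_setC_eball_polar _ _ (fun y => G y * frac_kernel s y)%R); [|exact: e0| |]; first last.
- by move=> y; rewrite mulr_ge0// frac_kernel_ge0.
- by apply: measurable_funM => //; exact: measurable_frac_kernel.
apply: eq_integral => v _.
have [/andP[v1 _]|v1] := boolP (1 <= enorm v < 2)%R; last first.
  by rewrite /ray_weight /annulus_weight (negbTE v1) !mul0r !mul0e.
have v0 : (0 < enorm v)%R by exact: lt_le_trans v1.
rewrite /ray_weight EFinM -muleA; congr (_ * _).
rewrite -ge0_integralZl; first last.
- by rewrite lee_fin frac_kernel_ge0.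
- by move=> w _; rewrite lee_fin mulr_ge0 ?powR_ge0.
- apply/measurable_EFinP; apply: measurable_funTS; apply: measurable_funM.
    apply: (measurableT_comp mG).
    exact: (measurableT_comp (@measurable_fun_ray R n) (pair1_measurable v)).
  exact: measurable_powR.
- exact: measurable_itv.
apply: eq_integral => w; rewrite inE/= in_itv/= => /andP[w0 _].
by rewrite -EFinM -mulrA frac_kernel_ray// mulrCA.
Qed.

(** The interval depends on [v]; moving this constraint into the integrand reduces the claim to
    Tonelli. *)
Lemma measurable_ray_integral (eps : R) (H : 'rV[R]_n * R -> R) :
  measurable_fun setT H -> (forall p, (0 <= H p)%R) ->
  measurable_fun setT (fun v => \int[mu]_(w in `]0%R, (enorm v / eps)%R[) (H (v, w))%:E).
Proof.
move=> mH H0.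
pose h p := (if (0 < p.2) && (p.2 < enorm p.1 / eps) then H p else 0)%R.
have mh : measurable_fun setT (EFin \o h).
  apply/measurable_EFinP; apply: measurable_fun_ifT => //.
  apply: (@measurable_and _ _ setT (fun p : 'rV[R]_n * R => 0 < p.2)%R
      (fun p : 'rV[R]_n * R => p.2 < enorm p.1 / eps)%R).
    by apply: measurable_fun_ltr => //; exact: measurable_snd.
  apply: measurable_fun_ltr; first exact: measurable_snd.
  apply: measurable_funM => //.
  by apply: (measurableT_comp (@measurable_enorm R n)); exact: measurable_fst.
have h0 p : 0 <= (EFin \o h) p by rewrite lee_fin /h; case: ifP.
have := @measurable_fun_fubini_tonelli_F _ _ _ _ _ mu (EFin \o h) mh h0.
congr (measurable_fun _ _); apply/funext => v.
rewrite /fubini_F [RHS]integral_mkcond; apply: eq_integral => w _.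
by rewrite patchE mem_setE in_itv/= /h/=; case: ifP.
Qed.

(** The bound |P - Q| <= E, obtained ray by ray from [ridge_ray_integral]. It is split into two
    inequalities without subtraction because the finiteness of [Q] is itself deduced from the last
    one. *)
Lemma ridge_second_difference s L sg x (eps : R) : (0 < s < 1)%R -> (`|sg| <= 1)%R ->
  (0 < L + sg * x ord0 i)%R -> (0 < eps)%R -> (2 * eps <= L + sg * x ord0 i)%R ->
  let P := \int[leb]_(y in ~` eball eps) (2 * ridge s L sg x * frac_kernel s y)%:E in
  let Q := \int[leb]_(y in ~` eball eps)
     ((ridge s L sg (x - y) + ridge s L sg (x + y)) * frac_kernel s y)%:E in
  let E := (16 * (L + sg * x ord0 i) `^ (s - 2) * eps `^ (2 - 2 * s))%:E *
     \int[leb]_v (ray_weight s v)%:E in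
  [/\ P < +oo, P <= Q + E & Q <= P + E].
Proof.
move=> s01 sg1 l0 e0 el P Q E; have /andP[s0 s1] := s01.
pose l := (L + sg * x ord0 i)%R.
pose c := (16 * l `^ (s - 2) * eps `^ (2 - 2 * s))%R.
have c0 : (0 <= c)%R by rewrite !mulr_ge0 ?powR_ge0.
pose p v := (l `^ s * (enorm v / eps) `^ (2 * s) / s)%R.
have p0 v : (0 <= p v)%R by rewrite !mulr_ge0 ?powR_ge0 ?invr_ge0 ?(ltW s0).
have mp : measurable_fun setT p.
  apply: measurable_funM => //; apply: measurable_funM => //.
  apply: (measurableT_comp (measurable_powR _)).
  by apply: measurable_funM => //; exact: measurable_enorm.
pose H (q : 'rV[R]_n * R) := ((ridge s L sg (x - q.2^-1 *: q.1) +
   ridge s L sg (x + q.2^-1 *: q.1)) * q.2 `^ (2 * s - 1))%R.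
have mG : measurable_fun setT (fun y => ridge s L sg (x - y) + ridge s L sg (x + y))%R.
  apply: measurable_funD; apply: (measurableT_comp (measurable_ridge _ _ _)).
    exact: measurable_subrV.
  exact: measurable_addrV.
have G0 y : (0 <= ridge s L sg (x - y) + ridge s L sg (x + y))%R.
  by rewrite addr_ge0 ?ridge_ge0.
have mH : measurable_fun setT H.
  apply: measurable_funM; first exact: (measurableT_comp mG (@measurable_fun_ray R n)).
  by apply: (measurableT_comp (measurable_powR _)); exact: measurable_snd.
have H0 q : (0 <= H q)%R by rewrite mulr_ge0 ?powR_ge0.
pose q v := \int[mu]_(w in `]0%R, (enorm v / eps)%R[) (H (v, w))%:E.
have mq : measurable_fun setT q by exact: measurable_ray_integral.
have q0 v : 0 <= q v by apply: integral_ge0 => w _; rewrite lee_fin.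
have EP : P = \int[leb]_v ((ray_weight s v)%:E * (p v)%:E).
  rewrite /P (@frac_kernel_polar s eps (fun=> 2 * ridge s L sg x)%R)//; last first.
    by move=> y; rewrite mulr_ge0 ?ridge_ge0.
  apply: eq_integral => v _.
  have [/andP[v1 v2]|v1] := boolP (1 <= enorm v < 2)%R; last first.
    by rewrite /ray_weight /annulus_weight (negbTE v1) !mul0r !mul0e.
  have v0 : (0 < enorm v)%R by exact: lt_le_trans v1.
  congr (_ * _); under eq_integral do rewrite EFinM.
  rewrite ge0_integralZl; first last.
  - by rewrite lee_fin mulr_ge0 ?ridge_ge0.
  - by move=> w _; rewrite lee_fin powR_ge0.
  - by apply/measurable_EFinP; apply: measurable_funTS; exact: measurable_powR.
  - exact: measurable_itv.
  rewrite powR_integral ?mulr_gt0 ?invr_gt0// -EFinM /p; congr (_%:E).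
  by rewrite /ridge tpowE ?(ltW l0)// -/l; field; rewrite gt_eqF.
have EQ : Q = \int[leb]_v ((ray_weight s v)%:E * q v).
  by rewrite /Q (@frac_kernel_polar s eps _ e0 mG G0).
have EE : E = \int[leb]_v ((ray_weight s v)%:E * c%:E).
  rewrite /E -ge0_integralZl; first last.
  - by rewrite lee_fin.
  - by move=> v _; rewrite lee_fin ray_weight_ge0.
  - by apply/measurable_EFinP; exact: measurable_ray_weight.
  - exact: measurableT.
  by apply: eq_integral => v _; rewrite muleC.
have mw : measurable_fun setT (fun v => (ray_weight s v)%:E).
  by apply/measurable_EFinP; exact: measurable_ray_weight.
have mwp : measurable_fun setT (fun v => (ray_weight s v)%:E * (p v)%:E).
  by apply: emeasurable_funM => //; exact/measurable_EFinP.
have mwq : measurable_fun setT (fun v => (ray_weight s v)%:E * q v).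
  exact: emeasurable_funM.
have mwc : measurable_fun setT (fun v => (ray_weight s v)%:E * c%:E).
  exact: emeasurable_funM.
have w0 v : 0 <= (ray_weight s v)%:E by rewrite lee_fin ray_weight_ge0.
have wp0 v : setT v -> 0 <= (ray_weight s v)%:E * (p v)%:E by move=> _; rewrite mule_ge0// lee_fin.
have wq0 v : setT v -> 0 <= (ray_weight s v)%:E * q v by move=> _; exact: mule_ge0.
have wc0 v : setT v -> 0 <= (ray_weight s v)%:E * c%:E by move=> _; rewrite mule_ge0// lee_fin.
have qp v : (ray_weight s v)%:E * (p v)%:E <= (ray_weight s v)%:E * q v + (ray_weight s v)%:E * c%:E
  /\ (ray_weight s v)%:E * q v <= (ray_weight s v)%:E * (p v)%:E + (ray_weight s v)%:E * c%:E.
  have [v1|v1] := boolP (1 <= enorm v < 2)%R; last first.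
    by rewrite /ray_weight /annulus_weight (negbTE v1) !mul0r !mul0e adde0.
  have [e eb eE] := ridge_ray_integral s01 sg1 l0 v1 e0 el.
  have -> : q v = (p v + e)%:E by rewrite /q /H /= eE.
  move: eb; rewrite ler_norml -/l -/c => /andP[e1 e2].
  have wv := ray_weight_ge0 s v.
  by rewrite -!EFinM -!EFinD -!mulrDr !lee_fin !ler_wpM2l//; lra.
split.
- rewrite EP; pose c' := (l `^ s * (2 / eps) `^ (2 * s) / s)%R.
  have c'0 : (0 <= c')%R by rewrite !mulr_ge0 ?powR_ge0 ?invr_ge0 ?(ltW s0).
  apply: (@le_lt_trans _ _ (\int[leb]_v (c'%:E * (ray_weight s v)%:E))).
    apply: ge0_le_integral => //; first exact: (emeasurable_funM (measurable_cst _) mw).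
    move=> v _; rewrite muleC /ray_weight /annulus_weight.
    case: ifPn => [/andP[v1 v2]|]; last by rewrite mul0r !mule0.
    have v0 : (0 < enorm v)%R by exact: lt_le_trans v1.
    rewrite lee_wpmul2r ?lee_fin ?mulr_ge0 ?frac_kernel_ge0 ?(ltW v0)//.
    rewrite /p /c' ler_wpM2r ?invr_ge0 ?(ltW s0)// ler_wpM2l ?powR_ge0//.
    rewrite ge0_ler_powR ?nnegrE ?divr_ge0 ?mulr_ge0 ?(ltW e0) ?(ltW v0) ?(ltW s0)//.
    by rewrite ler_wpM2r ?invr_ge0 ?(ltW e0) ?(ltW v2).
  rewrite ge0_integralZl; [|exact: measurableT|exact: mw|by move=> v _; exact: w0|by rewrite lee_fin].
  rewrite lte_mul_pinfty ?lee_fin//; exact: ray_weight_lty.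
- rewrite EP EQ EE -ge0_integralD//.
  apply: ge0_le_integral => //.
  + by apply: emeasurable_funD.
  + by move=> v _; have [] := qp v.
- rewrite EP EQ EE -ge0_integralD//.
  apply: ge0_le_integral => //.
  + by apply: emeasurable_funD.
  + by move=> v _; have [] := qp v.
Qed.

End truncated_power_harmonic.

(** * Ridge functions belong to [Hs] *)

Section ridge_harmonic.
Local Open Scope ereal_scope.
Context {R : realType} (n : nat) (i : 'I_n).
Notation mu := (@lebesgue_measure R).
Notation leb := (lebesgue_rV R n).
Implicit Types (s L sg : R) (x y v : 'rV[R]_n).

(** The reflection y |-> - y preserves the kernel and the excised ball, so the truncated fractional
    Laplacian is half the integral of a second difference. *)
Lemma ridge_shift_integral s L sg x (eps : R) :
  \int[leb]_(y in ~` eball eps)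
     ((ridge i s L sg (x - y) + ridge i s L sg (x + y)) * frac_kernel s y)%:E =
  2%:E * \int[leb]_(y in ~` eball eps) (ridge i s L sg (x - y) * frac_kernel s y)%:E.
Proof.
have mB : measurable (~` eball eps : set 'rV[R]_n) by apply: measurableC; exact: measurable_eball.
have mK := @measurable_frac_kernel R n s.
have mf1 : measurable_fun setT (fun y => ridge i s L sg (x - y) * frac_kernel s y)%R.
  apply: measurable_funM => //.
  exact: (measurableT_comp (measurable_ridge i s L sg) (measurable_subrV x)).
have mf2 : measurable_fun setT (fun y => ridge i s L sg (x + y) * frac_kernel s y)%R.
  apply: measurable_funM => //.
  exact: (measurableT_comp (measurable_ridge i s L sg) (measurable_addrV x)).
have f10 y : (0 <= ridge i s L sg (x - y) * frac_kernel s y)%R.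
  by rewrite mulr_ge0 ?ridge_ge0 ?frac_kernel_ge0.
have f20 y : (0 <= ridge i s L sg (x + y) * frac_kernel s y)%R.
  by rewrite mulr_ge0 ?ridge_ge0 ?frac_kernel_ge0.
have E2 := integral_setC_eball_oppr eps mf2 f20.
under eq_integral do rewrite mulrDl EFinD.
rewrite ge0_integralD; first last.
- by apply/measurable_EFinP; apply: measurable_funTS; exact: mf2.
- by move=> y _; rewrite lee_fin f20.
- by apply/measurable_EFinP; apply: measurable_funTS; exact: mf1.
- by move=> y _; rewrite lee_fin f10.
- exact: mB.
have -> : \int[leb]_(y in ~` eball eps) (ridge i s L sg (x + y) * frac_kernel s y)%:E =
    \int[leb]_(y in ~` eball eps) (ridge i s L sg (x - y) * frac_kernel s y)%:E.
  rewrite -E2; apply: eq_integral => y _.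
  by rewrite /frac_kernel -(scaleN1r y) enormZ normrN1 mul1r.
by move: (\int[_]_(y in _) _) => q; rewrite mule_natl mule2n.
Qed.

Lemma ge0_mul2_lty (z : \bar R) : 0 <= z -> 2%:E * z < +oo -> z < +oo.
Proof. by case: z => [t _ _|_|//]; [exact: ltry|rewrite mulry gtr0_sg// mul1e]. Qed.

Lemma norm_fineB_le (p q : \bar R) (z : R) : p \is a fin_num -> q \is a fin_num ->
  2%:E * p <= 2%:E * q + z%:E -> 2%:E * q <= 2%:E * p + z%:E -> (`|fine p - fine q| <= z)%R.
Proof.
case: p q => [p| |] [q| |]// _ _; rewrite -!EFinM -!EFinD !lee_fin/= => h1 h2.
rewrite ler_norml; apply/andP; split; lra.
Qed.

(** By [ridge_second_difference] the integral outside the ball of radius eps is O(eps^(2 - 2 s)),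
    with a positive exponent; so the principal value exists and is 0. *)
Lemma frac_laplacian_ridge s L sg x : (0 < s < 1)%R -> (`|sg| <= 1)%R ->
  (0 < L + sg * x ord0 i)%R -> frac_laplacian s (ridge i s L sg) x = 0%R.
Proof.
move=> s01 sg1 l0; have /andP[s0 s1] := s01.
set u := ridge i s L sg; set l := (L + sg * x ord0 i)%R in l0 *.
have C_fin : \int[leb]_v (ray_weight s v)%:E \is a fin_num.
  rewrite ge0_fin_numE; first exact: ray_weight_lty.
  by apply: integral_ge0 => v _; rewrite lee_fin ray_weight_ge0.
pose M := (16 * l `^ (s - 2) * fine (\int[leb]_v (ray_weight s v)%:E))%R.
pose I eps := (\int[leb]_(y in ~` eball eps) ((u x - u (x - y)) / enorm y `^ (n%:R + 2 * s)))%R.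
have IM (eps : R) : (0 < eps)%R -> (2 * eps <= l)%R -> (`|I eps| <= M * eps `^ (2 - 2 * s))%R.
  move=> e0 el.
  have mB : measurable (~` eball eps : set 'rV[R]_n) by apply: measurableC; exact: measurable_eball.
  have f10 y : (0 <= u x * frac_kernel s y)%R by rewrite mulr_ge0 ?ridge_ge0 ?frac_kernel_ge0.
  have f20 y : (0 <= u (x - y) * frac_kernel s y)%R by rewrite mulr_ge0 ?ridge_ge0 ?frac_kernel_ge0.
  have mf1 : measurable_fun (~` eball eps) (fun y => (u x * frac_kernel s y)%:E).
    apply/measurable_EFinP; apply: measurable_funTS; apply: measurable_funM => //.
    exact: measurable_frac_kernel.
  have mf2 : measurable_fun (~` eball eps) (fun y => (u (x - y) * frac_kernel s y)%:E).
    apply/measurable_EFinP; apply: measurable_funTS; apply: measurable_funM.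
      exact: (measurableT_comp (measurable_ridge i s L sg) (measurable_subrV x)).
    exact: measurable_frac_kernel.
  have EP : \int[leb]_(y in ~` eball eps) (2 * u x * frac_kernel s y)%:E =
      2%:E * \int[leb]_(y in ~` eball eps) (u x * frac_kernel s y)%:E.
    rewrite -ge0_integralZl; first last.
    - by [].
    - by move=> y _; rewrite lee_fin f10.
    - exact: mf1.
    - exact: mB.
    by apply: eq_integral => y _; rewrite -EFinM mulrA.
  have IE : \int[leb]_(y in ~` eball eps) (u x * frac_kernel s y)%:E < +oo ->
      \int[leb]_(y in ~` eball eps) (u (x - y) * frac_kernel s y)%:E < +oo ->
      I eps = (fine (\int[leb]_(y in ~` eball eps) (u x * frac_kernel s y)%:E)
        - fine (\int[leb]_(y in ~` eball eps) (u (x - y) * frac_kernel s y)%:E))%R.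
    move=> Poo Qoo; rewrite /I; under eq_Rintegral do rewrite mulrBl.
    rewrite RintegralB; [by []|exact: mB| |].
    - apply/integrableP; split; first exact: mf1.
      rewrite (eq_integral (fun y => (u x * frac_kernel s y)%:E)) => [|y _].
        exact: Poo.
      by rewrite gee0_abs// lee_fin f10.
    - apply/integrableP; split; first exact: mf2.
      rewrite (eq_integral (fun y => (u (x - y) * frac_kernel s y)%:E)) => [|y _].
        exact: Qoo.
      by rewrite gee0_abs// lee_fin f20.
  have P0 : 0 <= \int[leb]_(y in ~` eball eps) (u x * frac_kernel s y)%:E.
    by apply: integral_ge0 => y _; rewrite lee_fin f10.
  have Q0 : 0 <= \int[leb]_(y in ~` eball eps) (u (x - y) * frac_kernel s y)%:E.
    by apply: integral_ge0 => y _; rewrite lee_fin f20.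
  have [] := ridge_second_difference s01 sg1 l0 e0 el.
  rewrite ridge_shift_integral -/u -/l EP -(fineK C_fin) -EFinM mulrAC -/M.
  move: P0 Q0 IE; clear EP mf1 mf2.
  move: (\int[leb]_(y in ~` eball eps) (u x * frac_kernel s y)%:E)
    (\int[leb]_(y in ~` eball eps) (u (x - y) * frac_kernel s y)%:E).
  move=> P Q P0 Q0 IE Poo PQ QP.
  have P1oo : P < +oo := ge0_mul2_lty P0 Poo.
  have Qoo : Q < +oo.
    by apply: (ge0_mul2_lty Q0); apply: (le_lt_trans QP); apply: lte_add_pinfty => //; exact: ltry.
  by rewrite (IE P1oo Qoo); apply: norm_fineB_le; rewrite ?ge0_fin_numE.
have M0 : (0 <= M)%R.
  rewrite !mulr_ge0 ?powR_ge0// fine_ge0//.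
  by apply: integral_ge0 => v _; rewrite lee_fin ray_weight_ge0.
(* [M] is only known to be nonnegative; [M + 1] can be divided by. *)
have M1 : (0 < M + 1)%R by rewrite ltr_wpDl.
have a0 : (0 < 2 - 2 * s)%R by lra.
apply/cvg_lim => //.
apply/cvgr0Pnorm_le => e e0; near=> eps.
have eps0 : (0 < eps)%R by near: eps; exact: nbhs_right_gt.
have epsl : (2 * eps <= l)%R.
  rewrite mulrC -ler_pdivlMr//; near: eps; apply: nbhs_right_le; exact: divr_gt0.
apply: (le_trans (IM eps eps0 epsl)).
apply: (@le_trans _ _ ((M + 1) * eps `^ (2 - 2 * s))%R).
  by rewrite ler_wpM2r ?powR_ge0// lerDl.
rewrite mulrC -ler_pdivlMr//.
have : (eps `^ (2 - 2 * s) < e / (M + 1))%R.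
  near: eps.
  have := @powR_cvg0 R (2 - 2 * s)%R a0.
  by move=> /cvgr_lt; apply; rewrite divr_gt0.
exact: ltW.
Unshelve. all: by end_near. Qed.

Lemma continuous_affine_coord L sg : continuous (fun x : 'rV[R]_n => L + sg * x ord0 i)%R.
Proof.
move=> x; apply: (@continuous_comp _ _ _ (fun x : 'rV[R]_n => x ord0 i) (fun t : R => L + sg * t)%R).
  exact: coord_continuous.
by apply: cvgD; [exact: cvg_cst|apply: cvgM; [exact: cvg_cst|exact: cvg_id]].
Qed.

Lemma continuous_ridge s L sg : (0 < s)%R -> continuous (ridge i s L sg).
Proof.
move=> s0 x; apply: (@continuous_comp _ _ _ (fun x : 'rV[R]_n => L + sg * x ord0 i)%R (tpow s)).
  exact: continuous_affine_coord.
exact: continuous_tpow.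
Qed.

(** Arbitrary [c] and [a] make the form stable under partial derivatives, which lower [a] by 1. The
    formula is required on [A] alone, since a ridge function is a pure power only where its argument
    is positive; as [A] is open, this determines the derivatives there. *)
Lemma Ck_affine_powR (k : nat) (A : set 'rV[R]_n) L sg (c a : R) (f : 'rV[R]_n -> R) :
  open A -> (forall x, A x -> 0 < L + sg * x ord0 i)%R ->
  (forall x, A x -> f x = c * (L + sg * x ord0 i) `^ a)%R -> Ck k A f.
Proof.
move=> oA Apos; elim: k c a f => [|k IH] c a f fE.
  split => // x Ax.
  have : {for x, continuous (fun y : 'rV[R]_n => c * (L + sg * y ord0 i) `^ a)%R}.
    apply: (@continuous_comp _ _ _ (fun y : 'rV[R]_n => L + sg * y ord0 i)%R (fun t => c * t `^ a)%R).
      exact: continuous_affine_coord.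
    by apply: cvgM; [exact: cvg_cst|apply: continuous_powR; exact: Apos].
  rewrite /prop_for /continuous_at -fE//; apply: cvg_trans.
  apply: (@near_eq_cvg _ _ (nbhs x)).
  by apply: filterS (open_nbhs_nbhs (conj oA Ax)) => y Ay; rewrite fE.
have D x (j : 'I_n) : A x -> is_derive x (delta_mx ord0 j : 'rV[R]_n) f
    (c * a * sg * (i == j)%:R * (L + sg * x ord0 i) `^ (a - 1))%R.
  move=> Ax.
  set l := (L + sg * x ord0 i)%R; pose d := (sg * (i == j)%:R)%R.
  pose G (h : R) := (c * (l + d * h) `^ a)%R.
  have l0 : (0 < l)%R by exact: Apos.
  have [dG1 dG2] : is_derive (0%R : R) 1%R G (c *: ((a * l `^ (a - 1)) * d))%R.
    apply: is_deriveZ; apply: (@is_derive1_comp _ (fun t => t `^ a)%R (fun h => l + d * h)%R).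
      by rewrite mulr0 addr0; exact: is_derive1_powR.
    rewrite -[X in is_derive _ _ _ X]add0r; apply: is_deriveD.
    by rewrite -[X in is_derive _ _ _ X]mulr1; exact: (@is_deriveZ _ _ _ id).
  have cG : h^-1 *: ((f \o shift x) (h *: delta_mx ord0 j) - f x)%R @[h --> (0%R : R)^'] -->
      (c * a * sg * (i == j)%:R * l `^ (a - 1))%R.
    have -> : (c * a * sg * (i == j)%:R * l `^ (a - 1) = c *: ((a * l `^ (a - 1)) * d))%R.
      by rewrite /GRing.scale/= /d; ring.
    rewrite -dG2; apply: cvg_trans dG1; apply: near_eq_cvg; near=> h.
    have Ah : A (h *: delta_mx ord0 j + x)%R.
      near: h; apply: nbhs_dnbhs.
      have : {for (0%R : R), continuous (fun h : R => h *: (delta_mx ord0 j : 'rV[R]_n) + x)%R}.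
        by apply: continuousD; [exact: scalel_continuous|exact: cst_continuous].
      rewrite /prop_for /continuous_at scale0r add0r; apply.
      exact: open_nbhs_nbhs.
    rewrite /= !fE// /G mulr0 addr0 !mxE eqxx/= [(h *: 1)%R]mulr1 addr0.
    congr (_ *: (c * _ `^ a - _))%R; rewrite /d /l; ring.
  split; first by apply/cvg_ex; eexists; exact: cG.
  exact/cvg_lim.
split.
  by move: (IH c a f fE); case: (k) => [|k'] /= [].
move=> j; split; first by move=> x Ax; have [] := D x j Ax.
apply: (IH (c * a * sg * (i == j)%:R)%R (a - 1)%R) => x Ax.
by have [_ ->] := D x j Ax.
Unshelve. all: by end_near. Qed.

(** Outside the unit ball the weight is dominated by [frac_kernel]; inside, it is at most 1 and [u]
    is bounded. *)
Lemma integral_frac_tail s (u : 'rV[R]_n -> R) (M : R) : (0 < s)%R ->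
  measurable_fun setT u -> (forall y, 0 <= u y)%R ->
  (forall y, enorm y < 1 -> u y <= M)%R ->
  \int[leb]_(y in ~` eball 1) (u y * frac_kernel s y)%:E < +oo ->
  \int[leb]_y (`|u y| / (1 + enorm y `^ (n%:R + 2 * s)))%:E < +oo.
Proof.
move=> s0 mu' u0 uM tl.
have mB : measurable (eball 1 : set 'rV[R]_n) by exact: measurable_eball.
pose g y := (`|u y| / (1 + enorm y `^ (n%:R + 2 * s)))%R.
have g0 y : (0 <= g y)%R by rewrite divr_ge0// addr_ge0// powR_ge0.
have mg D : measurable_fun D (fun y => (g y)%:E).
  apply: measurable_funTS; apply/measurable_EFinP; apply: measurable_funM.
    exact: measurableT_comp.
  apply: measurable_invr_fun; apply: measurable_funD => //.
  exact: measurable_enorm_powR.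
rewrite -(setvU (eball 1)) ge0_integral_setU//; first last.
- by apply/disj_setPS => y [].
- by move=> y _; rewrite lee_fin g0.
- exact: measurableC.
apply: lte_add_pinfty.
  apply: le_lt_trans tl; apply: ge0_le_integral.
  - exact: measurableC.
  - by move=> y _; rewrite lee_fin g0.
  - exact: mg.
  - apply: measurable_funTS; apply/measurable_EFinP; apply: measurable_funM => //.
    exact: measurable_frac_kernel.
  move=> y /= y1; rewrite lee_fin /g ger0_norm// /frac_kernel.
  have y1' : (0 < enorm y)%R by rewrite (@lt_le_trans _ _ 1%R)// leNgt; exact/negP.
  by rewrite ler_wpM2l// lef_pV2 ?posrE ?powR_gt0 ?lerDr// addr_gt0// powR_gt0.
have M0 : (0 <= M)%R by apply: le_trans (uM 0%R _) => //; rewrite enorm0.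
apply: (@le_lt_trans _ _ (\int[leb]_(y in eball 1) cst M%:E y)).
  apply: ge0_le_integral.
  - exact: mB.
  - by move=> y _; rewrite lee_fin g0.
  - exact: mg.
  - exact: measurable_cst.
  move=> y /= y1; rewrite lee_fin /g ger0_norm//.
  rewrite ler_pdivrMr ?ltr_wpDr ?powR_ge0//; apply: (le_trans (uM _ y1)).
  by rewrite ler_peMr// lerDl powR_ge0.
rewrite integral_cst// lte_mul_pinfty ?lee_fin//.
apply: (@le_lt_trans _ _ (leb (rbox 0 1))).
  apply: le_measure; rewrite ?inE//; first exact: measurable_rbox.
  move=> y /= y1 j; rewrite mxE subr0; exact: le_lt_trans (ler_coord_enorm _ _) y1.
by rewrite lebesgue_rV_rbox// ltry.
Qed.

(** The growth condition comes from [ridge_second_difference] at x = 0 with eps = 1, which asks for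
    2 <= L: the finite integral [Q] of u(-y) + u(y) dominates that of u(y). *)
Lemma Hs_ridge s L sg (A : set 'rV[R]_n) : (0 < s < 1)%R -> (`|sg| <= 1)%R -> (2 <= L)%R ->
  open A -> (forall x, A x -> 0 < L + sg * x ord0 i)%R -> Hs s A (ridge i s L sg).
Proof.
move=> s01 sg1 L2 oA Apos; have /andP[s0 s1] := s01; split.
- exact: continuous_ridge.
- apply: (@integral_frac_tail s _ ((L + 1) `^ s)%R) => //.
  + exact: measurable_ridge.
  + by move=> y; exact: ridge_ge0.
  + move=> y y1; rewrite /ridge /tpow ge0_ler_powR ?(ltW s0) ?nnegrE//.
    * by rewrite le_max lexx.
    * by lra.
    rewrite ge_max; apply/andP; split; first by lra.
    rewrite lerD2l (le_trans (ler_norm _))// normrM.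
    apply: mulr_ile1 => //; apply: (le_trans (ler_coord_enorm y i)); exact: ltW.
  have l0 : (0 < L + sg * (0 : 'rV[R]_n) ord0 i)%R by rewrite mxE mulr0 addr0; lra.
  have el : (2 * 1 <= L + sg * (0 : 'rV[R]_n) ord0 i)%R by rewrite mxE mulr0 addr0; lra.
  have [Poo _ QP] := ridge_second_difference s01 sg1 l0 ltr01 el.
  apply: le_lt_trans (le_lt_trans QP _); last first.
    apply: lte_add_pinfty => //; apply: lte_mul_pinfty.
    + by rewrite lee_fin !mulr_ge0 ?powR_ge0.
    + by [].
    + exact: ray_weight_lty.
  apply: ge0_le_integral => //.
  + by apply: measurableC; exact: measurable_eball.
  + by move=> y _; rewrite lee_fin mulr_ge0 ?ridge_ge0 ?frac_kernel_ge0.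
  + apply/measurable_EFinP; apply: measurable_funTS; apply: measurable_funM.
      exact: measurable_ridge.
    exact: measurable_frac_kernel.
  + apply/measurable_EFinP; apply: measurable_funTS; apply: measurable_funM.
      apply: measurable_funD.
        exact: (measurableT_comp (measurable_ridge i s L sg) (measurable_subrV 0)).
      exact: (measurableT_comp (measurable_ridge i s L sg) (measurable_addrV 0)).
    exact: measurable_frac_kernel.
  + by move=> y _; rewrite lee_fin ler_wpM2r ?frac_kernel_ge0// (add0r y) lerDr ridge_ge0.
- apply: (@Ck_affine_powR 2 A L sg 1%R s) => // x Ax.
  by rewrite mul1r /ridge tpowE// ltW// Apos.
- by move=> x Ax; apply: frac_laplacian_ridge => //; exact: Apos.
Qed.

End ridge_harmonic.

(** * The mean value formula outside a ball *)

Section ridge_mean_value.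
Local Open Scope ereal_scope.
Context {R : realType} (n : nat) (i : 'I_n).
Notation mu := (@lebesgue_measure R).
Notation leb := (lebesgue_rV R n).
Implicit Types (s L sg r : R) (x y v : 'rV[R]_n).

Lemma ge0_mean_kernel s r y : (0 <= mean_kernel s r y)%R.
Proof.
rewrite /mean_kernel divr_ge0 ?powR_ge0// mulr_ge0 ?powR_ge0//.
by rewrite exprn_ge0 ?enorm_ge0.
Qed.

Lemma measurable_mean_kernel s r : measurable_fun setT (@mean_kernel R n s r).
Proof.
apply: measurable_funM => //; apply: measurable_invr_fun; apply: measurable_funM.
  apply: (measurableT_comp (measurable_powR s)); apply: measurable_funB => //.
  by apply: measurable_funX; exact: measurable_enorm.
by apply: measurable_funX; exact: measurable_enorm.
Qed.

(** In the variable t = r / |y| the radius disappears, and the dimension stays only in a factor that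
    depends on the direction vector [v]. *)
Lemma mean_kernel_ray s r v (t : R) : (0 < r)%R -> (0 < enorm v)%R -> (0 < t < 1)%R ->
  (mean_kernel s r ((r / enorm v / t) *: v) * ((enorm v / r) ^- n * t ^- n.+1) =
   enorm v ^- n * (t `^ (2 * s - 1) * (1 - t ^+ 2) `^ (- s)))%R.
Proof.
move=> r0 v0 /andP[t0 t1].
have t2 : (0 < 1 - t ^+ 2)%R by rewrite subr_gt0 expr_lt1// ltW.
rewrite /mean_kernel enormZ.
have -> : (`|r / enorm v / t| * enorm v = r / t)%R.
  rewrite gtr0_norm ?divr_gt0//; field; rewrite !gt_eqF//.
have -> : ((r / t) ^+ 2 - r ^+ 2 = r ^+ 2 * ((1 - t ^+ 2) * (t ^+ 2)^-1))%R.
  by field; rewrite gt_eqF.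
have t2V : (0 <= (t ^+ 2)^-1)%R by rewrite invr_ge0 sqr_ge0.
rewrite (@powRM _ (r ^+ 2)%R) ?sqr_ge0 ?mulr_ge0 ?(ltW t2)//.
rewrite (@powRM _ (1 - t ^+ 2)%R) ?(ltW t2)//.
rewrite gt0_powRV ?exprn_gt0//.
have sq (z : R) : (0 < z)%R -> ((z ^+ 2) `^ s = z `^ (2 * s))%R.
  by move=> z0; rewrite -(powR_mulrn _ (ltW z0)) -powRrM.
rewrite !sq// powRN (gt0_powRB _ _ t0) powRr1 ?(ltW t0)// (exprS t n) expr_div_n.
have g1 : (r `^ (2 * s) != 0)%R by rewrite gt_eqF// powR_gt0.
have g2 : (t `^ (2 * s) != 0)%R by rewrite gt_eqF// powR_gt0.
have g3 : ((1 - t ^+ 2) `^ s != 0)%R by rewrite gt_eqF// powR_gt0.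
have g4 : (r ^+ n != 0)%R by rewrite expf_neq0// gt_eqF.
have g5 : (t ^+ n != 0)%R by rewrite expf_neq0// gt_eqF.
have g6 : (enorm v ^+ n != 0)%R by rewrite expf_neq0// gt_eqF.
have g7 : (t != 0)%R by rewrite gt_eqF.
rewrite expr_div_n; move: (r `^ _)%R (t `^ _)%R (_ `^ s)%R (r ^+ n)%R (t ^+ n)%R (enorm v ^+ n)%R g1 g2 g3 g4 g5 g6.
move=> p1 p2 p3 p4 p5 p6 g1 g2 g3 g4 g5 g6.
by field; rewrite g1 g2 g3 g4 g5 g6 g7.
Qed.

(** The area of the unit sphere: on 1 <= |v| < 2 the integrand is |v|^(1-n), whose radial integral
    in each direction is 1. *)
Definition mean_mass : \bar R := \int[leb]_v (annulus_weight v * enorm v ^- n)%:E.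

(** On each ray the pair becomes the integrand of [tpow_mean_value], whose value does not depend on
    the shift. Hence the right-hand side is free of [sg], and [sg = 0] identifies it with the
    integral of the constant 2 L^s; this replaces the computation of the normalizing constant. *)
Lemma ridge_mean_value s L sg r : (0 < s < 1)%R -> (`|sg| <= 1)%R -> (0 < r < L)%R ->
  \int[leb]_(y in ~` eball r)
    ((ridge i s L sg y + ridge i s L (- sg) y) * mean_kernel s r y)%:E =
  (L `^ s)%:E * beta_integral s * mean_mass.
Proof.
move=> s01 sg1 /andP[r0 rL]; have /andP[s0 s1] := s01.
have L0 : (0 < L)%R by exact: lt_trans rL.
have mG : measurable_fun setT (fun y => (ridge i s L sg y + ridge i s L (- sg) y) * mean_kernel s r y)%R.
  apply: measurable_funM; last exact: measurable_mean_kernel.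
  by apply: measurable_funD; exact: measurable_ridge.
have G0 y : (0 <= (ridge i s L sg y + ridge i s L (- sg) y) * mean_kernel s r y)%R.
  by apply: mulr_ge0; [apply: addr_ge0; exact: ridge_ge0|exact: ge0_mean_kernel].
have beta0 : 0 <= beta_integral s.
  by apply: integral_ge0 => t _; rewrite lee_fin beta_density_ge0.
have mW : measurable_fun setT (fun v : 'rV[R]_n => (annulus_weight v * enorm v ^- n)%:E).
  apply/measurable_EFinP; apply: measurable_funM; first exact: measurable_annulus_weight.
  by apply: measurable_invr_fun; apply: measurable_funX; exact: measurable_enorm.
rewrite (integral_setC_eball_polar_unit r0 mG G0) /mean_mass -ge0_integralZl; first last.
- by rewrite mule_ge0// lee_fin powR_ge0.
- by move=> v _; rewrite lee_fin mulr_ge0 ?annulus_weight_ge0 ?invr_ge0 ?exprn_ge0 ?enorm_ge0.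
- exact: mW.
- exact: measurableT.
apply: eq_integral => v _.
have [/andP[v1 _]|v1] := boolP (1 <= enorm v < 2)%R; last first.
  by rewrite /annulus_weight (negbTE v1) !mul0r !(mul0e, mule0).
have v0 : (0 < enorm v)%R by exact: lt_le_trans v1.
(* [b] is [sg] times the i-th coordinate of the point where the ray meets the sphere of radius [r],
   so that |b| <= r < L. *)
pose b : R := (sg * (r / enorm v * v ord0 i))%R.
have b_r : (`|b| <= r)%R.
  rewrite /b normrM -[leRHS]mul1r ler_pM// normrM ger0_norm ?divr_ge0 ?(ltW r0) ?(ltW v0)//.
  by rewrite mulrAC ler_pdivrMr// ler_wpM2l ?(ltW r0)// ler_coord_enorm.
have c01 : (0 <= `|b| / L < 1)%R.
  by rewrite divr_ge0 ?(ltW L0)//= ltr_pdivrMr// mul1r (le_lt_trans b_r).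
rewrite -(tpow_mean_value s01 c01).
transitivity ((annulus_weight v)%:E * ((L `^ s * enorm v ^- n)%:E *
  \int[mu]_(x in `]0%R, 1%R[) ((tpow s (x + `|b| / L) + tpow s (x - `|b| / L)) *
     (x `^ (s - 1) * (1 - x ^+ 2) `^ (- s)))%:E)); last first.
  rewrite !EFinM; set X := \int[mu]_(_ in _) _.
  by rewrite (muleAC (L `^ s)%:E) muleCA.
congr (_ * _); rewrite -ge0_integralZl; first last.
- by rewrite lee_fin mulr_ge0 ?powR_ge0 ?invr_ge0 ?exprn_ge0 ?enorm_ge0.
- by move=> x _; rewrite lee_fin !mulr_ge0 ?powR_ge0 ?addr_ge0 ?tpow_ge0.
- apply/measurable_EFinP; apply: measurable_funTS; apply: measurable_funM.
    apply: measurable_funD; apply: (measurableT_comp (measurable_tpow s)).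
      exact: measurable_funD.
    exact: measurable_funB.
  apply: measurable_funM; first exact: measurable_powR.
  by apply: measurable_onem_powR; exact: exprn_measurable.
- exact: measurable_itv.
apply: eq_integral => t; rewrite inE/= in_itv/= => /andP[t0 t1].
have t01 : (0 < t < 1)%R by rewrite t0.
rewrite -EFinM; congr (_%:E).
rewrite -mulrA (mean_kernel_ray s r0 v0 t01) /ridge !mxE.
have -> : (L + sg * (r / enorm v / t * v ord0 i) = L + b / t)%R.
  by rewrite /b; field; rewrite !gt_eqF.
have -> : (L + - sg * (r / enorm v / t * v ord0 i) = L + (- b) / t)%R.
  by rewrite /b; field; rewrite !gt_eqF.
rewrite (tpow_ray s b L0 t0) (tpow_ray s (- b)%R L0 t0) mulNr -mulrDr.
have -> : (tpow s (t + b / L) + tpow s (t - b / L) =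
    tpow s (t + `|b| / L) + tpow s (t - `|b| / L))%R.
  by case: (ger0P b) => _ //; rewrite mulNr opprK addrC.
have -> : (t `^ (2 * s - 1) = t `^ s * t `^ (s - 1))%R.
  by rewrite -gt0_powRD//; congr (_ `^ _)%R; ring.
have tn : (t `^ s != 0)%R by rewrite gt_eqF// powR_gt0.
have vn : (enorm v ^+ n != 0)%R by rewrite expf_neq0// gt_eqF.
rewrite (powRN t s); move: (_ + tpow s _)%R => z.
by field; rewrite tn vn.
Qed.

Lemma mean_mass_lty : mean_mass < +oo.
Proof.
apply: le_lt_trans (annulus_weight_integral n); apply: ge0_le_integral.
- exact: measurableT.
- by move=> v _; rewrite lee_fin mulr_ge0 ?annulus_weight_ge0 ?invr_ge0 ?exprn_ge0 ?enorm_ge0.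
- apply/measurable_EFinP; apply: measurable_funM; first exact: measurable_annulus_weight.
  by apply: measurable_invr_fun; apply: measurable_funX; exact: measurable_enorm.
- by apply/measurable_EFinP; exact: measurable_annulus_weight.
move=> v _; rewrite lee_fin /annulus_weight; case: ifPn => [/andP[v1 _]|_]; last by rewrite mul0r.
rewrite -[leRHS]mulr1 ler_wpM2l ?enorm_ge0// invf_le1 ?exprn_ege1//.
by rewrite exprn_gt0// (lt_le_trans _ v1).
Qed.

(** The cut-off belongs to the density, so that [mean_measure] falls under [ge0_integral_density],
    which deals with densities on the whole space. *)
Definition mean_density s r y : R :=
  if (r <= enorm y)%R then (@mean_const R n s * mean_kernel s r y)%R else 0%R.

Lemma mean_const_ge0 s : (0 <= @mean_const R n s)%R.
Proof.
rewrite invr_ge0 fine_ge0//; apply: integral_ge0 => y _.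
by rewrite lee_fin ge0_mean_kernel.
Qed.

Lemma mean_density_ge0 s r y : (0 <= mean_density s r y)%R.
Proof.
by rewrite /mean_density; case: ifP => // _; rewrite mulr_ge0 ?mean_const_ge0 ?ge0_mean_kernel.
Qed.

Lemma measurable_mean_density s r : measurable_fun setT (mean_density s r).
Proof.
apply: measurable_fun_ifT => //.
  by apply: measurable_fun_ler => //; exact: measurable_enorm.
by apply: measurable_funM => //; exact: measurable_mean_kernel.
Qed.

Lemma integral_mean_density s r (A : set 'rV[R]_n) (f : 'rV[R]_n -> R) :
  \int[leb]_(y in A) (f y * mean_density s r y)%:E =
  \int[leb]_(y in A `\` eball r) (f y * (@mean_const R n s * mean_kernel s r y))%:E.
Proof.
rewrite [LHS]integral_mkcond [RHS]integral_mkcond; apply: eq_integral => y _.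
rewrite !patchE in_setD /mean_density.
have -> : (y \in eball r) = ~~ (r <= enorm y)%R.
  by rewrite -ltNge; apply/idP/idP; rewrite inE.
by case: (y \in A) => //=; case: ifP => //= _; rewrite mulr0.
Qed.

Lemma ge0_integral_mean_measure s r (f : 'rV[R]_n -> R) : measurable_fun setT f ->
  (forall y, (0 <= f y)%R) ->
  \int[@mean_measure R n s r]_y (f y)%:E = \int[leb]_y (f y * mean_density s r y)%:E.
Proof.
move=> mf f0; apply: (ge0_integral_density (measurable_mean_density s r)) => //.
  exact: mean_density_ge0.
move=> A mA.
rewrite (eq_integral (fun y => (1 * mean_density s r y)%:E)); last by move=> y _; rewrite mul1r.
rewrite integral_mean_density; apply: eq_integral => y _; by rewrite mul1r.
Qed.

Lemma ridge_mean_measure s L sg r : (0 < s < 1)%R -> (`|sg| <= 1)%R -> (0 < r < L)%R ->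
  \int[@mean_measure R n s r]_y (ridge i s L sg y + ridge i s L (- sg) y)%:E =
  (@mean_const R n s)%:E * ((L `^ s)%:E * beta_integral s * mean_mass).
Proof.
move=> s01 sg1 rL.
rewrite ge0_integral_mean_measure; first last.
- by move=> y; rewrite addr_ge0 ?ridge_ge0.
- by apply: measurable_funD; exact: measurable_ridge.
rewrite integral_mean_density setTD -(ridge_mean_value s01 sg1 rL) -ge0_integralZl; first last.
- by rewrite lee_fin mean_const_ge0.
- move=> y _; rewrite lee_fin.
  by apply: mulr_ge0; [apply: addr_ge0; exact: ridge_ge0|exact: ge0_mean_kernel].
- apply: measurable_funTS; apply/measurable_EFinP; apply: measurable_funM; last exact: measurable_mean_kernel.
  by apply: measurable_funD; exact: measurable_ridge.
- by apply: measurableC; exact: measurable_eball.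
by apply: eq_integral => y _; rewrite -EFinM mulrCA.
Qed.

End ridge_mean_value.

(** * Rigidity *)

Section strict_concavity.
Context {R : realType}.

(** For t > 0 the increments on the two sides of L are s x1^(s-1) t and s x2^(s-1) t with x1 < L <
    x2, and u^(s-1) is strictly decreasing. *)
Lemma powR_strictly_concave (s L t : R) : 0 < s < 1 -> `|t| < L -> t != 0 ->
  (L + t) `^ s + (L - t) `^ s < 2 * L `^ s.
Proof.
move=> /andP[s0 s1]; wlog t0 : t / 0 < t.
  move=> W tL tn0; have [t0|t0|t0] := ltgtP t 0; last by rewrite t0 eqxx in tn0.
    have := W (- t); rewrite normrN oppr_eq0 opprK addrC oppr_gt0; exact.
  exact: W.
rewrite gtr0_norm// => tL _.
have [|x1 /andP[x1l x1r] E1] := @powR_increment_lt R s L t; first by rewrite t0.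
have [|x2 /andP[x2l x2r] E2] := @powR_increment_lt R s (L + t) t; first by lra.
rewrite addrK in x2l E2.
have : x2 `^ (s - 1) < x1 `^ (s - 1).
  have x10 : 0 < x1 by lra.
  have x20 : 0 < x2 by lra.
  rewrite -(opprB 1 s) !powRN ltf_pV2 ?posrE ?powR_gt0//.
  by rewrite gt0_ltr_powR ?nnegrE ?subr_gt0 ?(ltW x10) ?(ltW x20)//; lra.
have st : 0 < s * t by rewrite mulr_gt0.
move=> h; have := h; rewrite -(ltr_pM2l st) => h'.
have e1 : s * x1 `^ (s - 1) * t = s * t * x1 `^ (s - 1) by ring.
have e2 : s * x2 `^ (s - 1) * t = s * t * x2 `^ (s - 1) by ring.
rewrite e1 in E1; rewrite e2 in E2; lra.
Qed.

End strict_concavity.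

(** * Cubes, balls and the distance to the boundary *)

Section boundary_distance.
Context {R : realType} (n : nat) (i : 'I_n).
Implicit Types (A : set 'rV[R]_n) (x y p : 'rV[R]_n).

Lemma ler_coord_norm x j : `|x ord0 j| <= `|x|.
Proof.
have /mapP[k Hk ->] : `|x ord0 j| \in [seq `|x k.1 k.2| | k : 'I_1 * 'I_n].
  by apply/mapP; exists (ord0, j) => //=; rewrite mem_enum.
by rewrite [leRHS]/Num.Def.normr /= mx_normrE; apply/bigmax_geP; right => /=; exists k.
Qed.

Lemma bounded_coord A : bounded_set A ->
  exists2 M : R, 0 < M & forall x, A x -> forall j, `|x ord0 j| < M.
Proof.
move=> [M [_ MA]]; exists (`|M| + 2); first by rewrite ltr_wpDl.
move=> x Ax j; apply: (@le_lt_trans _ _ (`|M| + 1)); last by rewrite ltrD2l ltr1n.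
apply: (le_trans (ler_coord_norm x j)); apply: (MA (`|M| + 1)) => //.
by rewrite (le_lt_trans (ler_norm _))// ltrDl.
Qed.

Lemma rbox_sub_open A x : open A -> A x -> exists2 d : R, 0 < d & rbox x d `<=` A.
Proof.
move=> oA Ax; have [d /= d0 dA] : exists2 d : R, 0 < d & ball x d `<=` A.
  by have /nbhs_ballP := open_nbhs_nbhs (conj oA Ax).
exists d => // y xy; apply: dA; split => // j k; rewrite (ord1 j).
by rewrite /ball/= distrC; exact: xy.
Qed.

(** The point of first exit: let [tau] be the infimum of the parameters in [0, 1] whose point is
    outside [A]. Openness keeps the point at [tau] outside [A], while all earlier points lie in
    [A]. *)
Lemma boundary_on_segment A p : open A -> A 0 -> ~ A p ->
  exists2 t : R, 0 <= t <= 1 & boundary A (t *: p).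
Proof.
move=> oA A0 Ap.
pose S := [set t : R | 0 <= t <= 1 /\ ~ A (t *: p)].
have S1 : S 1 by split; [rewrite ler01 lexx|rewrite scale1r].
have lS : has_lbound S by exists 0 => t [/andP[]].
have iS : has_inf S by split => //; exists 1.
pose tau := inf S.
have tau0 : 0 <= tau by apply: lb_le_inf; [exists 1|move=> t [/andP[]]].
have tau1 : tau <= 1 by apply: ge_inf.
have Alt t : 0 <= t < tau -> A (t *: p).
  move=> /andP[t0 tt]; apply: contrapT => nA.
  have : tau <= t.
    apply: ge_inf => //; split => //.
    by rewrite t0 (le_trans (ltW tt)).
  by rewrite leNgt tt.
have near_tau (B : set 'rV[R]_n) : nbhs (tau *: p) B ->
    exists2 e : R, 0 < e & forall t, `|t - tau| < e -> B (t *: p).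
  move=> nB.
  have /(_ B nB) : {for tau, continuous (fun t : R => t *: p)} by exact: scalel_continuous.
  rewrite /= => /nbhs_ballP[e /= e0 eB]; exists e => // t te.
  by apply: eB; rewrite /ball/= distrC.
have nAtau : ~ A (tau *: p).
  move=> At; have [e e0 eA] := near_tau A (open_nbhs_nbhs (conj oA At)).
  have [t St te] := inf_adherent e0 iS.
  have tt : tau <= t by apply: ge_inf.
  case: St => _; apply; apply: eA.
  by rewrite ger0_norm ?subr_ge0// ltrBlDl.
have taupos : 0 < tau.
  rewrite lt0r tau0 andbT; apply/eqP => t0; apply: nAtau.
  by rewrite t0 scale0r.
exists tau; first by rewrite tau0 tau1.
split; last by move=> /interior_subset.
move=> B /near_tau[e e0 eB].
pose t := Num.max 0 (tau - e / 2).
have tlt : t < tau by rewrite gt_max taupos/= gtrBl divr_gt0.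
have t0 : 0 <= t by rewrite le_max lexx.
exists (t *: p); split; first by apply: Alt; rewrite t0.
apply: eB; rewrite ltr0_norm ?subr_lt0// opprB ltrBlDr.
apply: (@lt_le_trans _ _ (e + (tau - e / 2))); last by rewrite lerD2l le_max lexx orbT.
lra.
Qed.

Lemma dist_boundary_le A y : boundary A y -> dist_to 0 (boundary A) <= enorm y.
Proof.
move=> By; apply: ge_inf; first by exists 0 => _ [z _ <-]; exact: enorm_ge0.
by exists y => //; rewrite sub0r -scaleN1r enormZ normrN1 mul1r.
Qed.

(** A point of the ball outside [A] would place a boundary point on the segment from the origin,
    closer than the distance allows. *)
Lemma eball_sub_open A : open A -> A 0 -> eball (dist_to 0 (boundary A)) `<=` A.
Proof.
move=> oA A0 p pr; apply: contrapT => nAp.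
have [t /andP[t0 t1] Bt] := boundary_on_segment oA A0 nAp.
have := dist_boundary_le Bt; rewrite enormZ ger0_norm// leNgt => /negP; apply.
apply: le_lt_trans pr; rewrite -[leRHS]mul1r ler_wpM2r// enorm_ge0//.
Qed.

Lemma dist_boundary_gt0 A : open A -> bounded_set A -> A 0 ->
  0 < dist_to 0 (boundary A).
Proof.
move=> oA bA A0; have [M M0 AM] := bounded_coord bA.
have [d d0 dA] := rbox_sub_open oA A0.
apply: (lt_le_trans d0); apply: lb_le_inf.
  (* The infimum of the empty set is 0 by default, so a boundary point must be exhibited. It lies on
     a segment along the i-th axis, which leaves the bounded set [A]. *)
  have nAp : ~ A (M *: delta_mx ord0 i).
    move=> /AM/(_ i); rewrite !mxE !eqxx/= mulr1 gtr0_norm//.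
    by rewrite ltxx.
  have [t _ Bt] := boundary_on_segment oA A0 nAp.
  by exists (enorm (0 - t *: (M *: delta_mx ord0 i))); exists (t *: (M *: delta_mx ord0 i)).
move=> _ [y [_ nAy] <-]; rewrite leNgt; apply/negP => yd; apply: nAy.
apply: open_nbhs_nbhs; split => //; apply: dA => j; rewrite mxE subr0.
apply: le_lt_trans yd; rewrite sub0r -scaleN1r enormZ normrN1 mul1r.
exact: ler_coord_enorm.
Qed.

(* Shifting q away from every coordinate hyperplane increases all |q_j|. *)
Lemma rbox_away A q : open A -> A q ->
  exists p, exists2 d : R, 0 < d &
    forall y, rbox p d y -> [/\ A y, enorm q < enorm y & y ord0 i != 0].
Proof.
move=> oA Aq; have [d d0 dA] := rbox_sub_open oA Aq.
pose sgn j : R := if 0 <= q ord0 j then 1 else -1.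
(* Shift and radius are both d / 2: the cube just fails to touch [q] and stays within distance [d]
   of it in every coordinate. *)
exists (\row_j (q ord0 j + sgn j * (d / 2))); exists (d / 2); first by rewrite divr_gt0.
move=> y yp.
have H j : `|q ord0 j| < `|y ord0 j| /\ `|y ord0 j - q ord0 j| < d.
  have := yp j; rewrite !mxE /sgn ltr_norml => /andP[h1 h2].
  move: h1 h2; have [q0|q0] := leP 0 (q ord0 j) => h1 h2.
    have y0 : 0 <= y ord0 j by lra.
    have yq : 0 <= y ord0 j - q ord0 j by lra.
    by rewrite (ger0_norm q0) (ger0_norm y0) (ger0_norm yq); split; lra.
  have y0 : y ord0 j < 0 by lra.
  have yq : y ord0 j - q ord0 j < 0 by lra.
  by rewrite (ltr0_norm q0) (ltr0_norm y0) (ltr0_norm yq); split; lra.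
split.
- by apply: dA => j; have [] := H j.
- rewrite /enorm ltr_sqrt.
    apply: ltr_sum; last by move=> j _; have [h _] := H j; rewrite -(real_normK (num_real (q ord0 j)))
      -(real_normK (num_real (y ord0 j))) ltrXn2r ?nnegrE.
    by apply/hasP; exists i => //; rewrite mem_index_enum.
  rewrite (bigD1 i)//= ltr_wpDr//; first by apply: sumr_ge0 => j _; exact: sqr_ge0.
  rewrite exprn_even_gt0//=; apply/negP => /eqP y0.
  by have [] := H i; rewrite y0 normr0 normr_lt0.
- by apply/negP => /eqP y0; have [] := H i; rewrite y0 normr0 normr_lt0.
Qed.

End boundary_distance.

(** * Vanishing of the concavity defect *)

Section defect.
Local Open Scope ereal_scope.
Context {R : realType} (n : nat) (i : 'I_n).
Notation leb := (lebesgue_rV R n).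

Lemma ridge_defect_null (s L r : R) (A : set 'rV[R]_n) : (0 < s < 1)%R -> (0 < r < L)%R ->
  measurable A -> (forall x, A x -> `|x ord0 i| < L)%R ->
  (forall sg, `|sg| <= 1 -> L `^ s = (fine (mean_measure s r (~` A)))^-1 *
     \int[mean_measure s r]_(y in ~` A) ridge i s L sg y)%R ->
  [/\ (0 < @mean_const R n s)%R,
   forall y, A y -> (0 <= 2 * L `^ s - (ridge i s L 1 y + ridge i s L (-1) y))%R &
  \int[leb]_(y in A) ((2 * L `^ s - (ridge i s L 1 y + ridge i s L (-1) y)) *
     mean_density s r y)%:E = 0].
Proof.
move=> s01 rL mA AL H; have /andP[s0 s1] := s01; have /andP[r0 rL'] := rL.
have L0 : (0 < L)%R by exact: lt_trans rL'.
pose a := (L `^ s)%R; have a0 : (0 < a)%R by exact: powR_gt0.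
pose mm : {measure set 'rV[R]_n -> \bar R} := mean_measure s r.
pose f (y : 'rV[R]_n) := (ridge i s L 1 y + ridge i s L (-1) y)%R.
have mf : measurable_fun setT f by apply: measurable_funD; exact: measurable_ridge.
have f0 y : (0 <= f y)%R by rewrite /f addr_ge0 ?ridge_ge0.
have mAC : measurable (~` A) by exact: measurableC.
have ridge0 y : ridge i s L 0 y = a by rewrite /ridge mul0r addr0 tpowE// ltW.
pose K := (@mean_const R n s)%:E * ((L `^ s)%:E * beta_integral s * mean_mass (R := R) n).
have K_lty : K < +oo.
  have b0 : 0 <= beta_integral s by apply: integral_ge0 => t _; rewrite lee_fin beta_density_ge0.
  have m0 : 0 <= mean_mass (R := R) n.
    apply: integral_ge0 => v _.
    by rewrite lee_fin mulr_ge0 ?annulus_weight_ge0 ?invr_ge0 ?exprn_ge0 ?enorm_ge0.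
  have bf : beta_integral s \is a fin_num by rewrite ge0_fin_numE// beta_integral_lty.
  have mf' : mean_mass (R := R) n \is a fin_num by rewrite ge0_fin_numE// mean_mass_lty.
  by rewrite /K -(fineK bf) -(fineK mf') -!EFinM ltry.
have Ef : \int[mm]_y (f y)%:E = K.
  by apply: ridge_mean_measure; rewrite ?normr1.
have Ea : \int[mm]_y (2 * a)%:E = K.
  have := @ridge_mean_measure R n i s L 0 r s01; rewrite normr0 ler01 oppr0 => /(_ isT rL) E.
  rewrite /K -E.
  by apply: eq_integral => y _; rewrite ridge0 mulr_natl mulr2n.
have mfD D : measurable_fun D (fun y => (f y)%:E).
  by apply: measurable_funTS; exact/measurable_EFinP.
have split_int (h : 'rV[R]_n -> R) : measurable_fun setT h -> (forall y, 0 <= h y)%R ->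
    \int[mm]_y (h y)%:E = \int[mm]_(y in A) (h y)%:E + \int[mm]_(y in ~` A) (h y)%:E.
  move=> mh h0; rewrite -[in LHS](setvU A) setUC ge0_integral_setU//.
  - by apply: measurable_funTS; exact/measurable_EFinP.
  - by move=> y _; rewrite lee_fin.
  - by apply/disj_setPS => y [].
have sub_int (h : 'rV[R]_n -> R) D : measurable D -> measurable_fun setT h -> (forall y, 0 <= h y)%R ->
    \int[mm]_(y in D) (h y)%:E <= \int[mm]_y (h y)%:E.
  move=> mD mh h0; apply: ge0_subset_integral => //.
  - exact/measurable_EFinP.
  - by move=> y _; rewrite lee_fin.
pose U := fine (mm (~` A)).
(* [fine] sends +oo to 0 and the inverse of 0 is 0, so in either degenerate case the hypothesis for
   [sg = 0] would read L^s = 0. *)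
have U_neq0 : U != 0%R.
  apply/eqP => U0; have := H 0%R; rewrite normr0 ler01 -/mm -/U U0 invr0 mul0r => /(_ isT) a_eq0.
  by move: a0; rewrite /a a_eq0 ltxx.
have Iridge sg : (`|sg| <= 1)%R -> fine (\int[mm]_(y in ~` A) (ridge i s L sg y)%:E) = (a * U)%R.
  move=> sg1; have := H sg sg1; rewrite -/mm -/U -/a /Rintegral => ->.
  by rewrite mulrAC mulVf// mul1r.
(* The hypothesis controls only [fine] of this integral; finiteness comes from the bound by [f],
   whose total integral [K] is finite. *)
have finI sg : (sg == 1%R) || (sg == -1)%R ->
    \int[mm]_(y in ~` A) (ridge i s L sg y)%:E = (a * U)%:E.
  move=> sgE; have sg1 : (`|sg| <= 1)%R by case/orP: sgE => /eqP ->; rewrite ?normrN1 ?normr1.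
  rewrite -(Iridge _ sg1) fineK// ge0_fin_numE; last first.
    by apply: integral_ge0 => y _; rewrite lee_fin ridge_ge0.
  apply: le_lt_trans (K_lty); rewrite -Ef.
  apply: le_trans (sub_int f _ mAC mf f0); apply: ge0_le_integral.
  - exact: mAC.
  - by move=> y _; rewrite lee_fin ridge_ge0.
  - by apply: measurable_funTS; apply/measurable_EFinP; exact: measurable_ridge.
  - exact: mfD.
  - move=> y _; rewrite lee_fin /f; case/orP: sgE => /eqP ->.
      by rewrite lerDl ridge_ge0.
    by rewrite lerDr ridge_ge0.
have finA : \int[mm]_(y in ~` A) (2 * a)%:E = (2 * (a * U))%:E.
  have fin2 : \int[mm]_(y in ~` A) (2 * a)%:E \is a fin_num.
    rewrite ge0_fin_numE; last by apply: integral_ge0 => y _; rewrite lee_fin mulr_ge0// ltW.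
    apply: le_lt_trans (K_lty); rewrite -Ea; apply: (sub_int (fun=> 2 * a)%R) => //.
    by move=> y; rewrite mulr_ge0// ltW.
  rewrite -(Iridge 0%R) ?normr0//.
  have -> : \int[mm]_(y in ~` A) (ridge i s L 0 y)%:E = (2^-1)%:E * \int[mm]_(y in ~` A) (2 * a)%:E.
    rewrite -ge0_integralZl; first last.
    - by rewrite lee_fin.
    - by move=> y _; rewrite lee_fin mulr_ge0// ltW.
    - exact: measurable_cst.
    - exact: mAC.
    by apply: eq_integral => y _; rewrite ridge0 -EFinM mulKf.
  by rewrite -(fineK fin2) -EFinM/= mulVKf.
have fC : \int[mm]_(y in ~` A) (f y)%:E = (2 * (a * U))%:E.
  under eq_integral do rewrite EFinD.
  rewrite ge0_integralD; first last.
  - by apply: measurable_funTS; apply/measurable_EFinP; exact: measurable_ridge.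
  - by move=> y _; rewrite lee_fin ridge_ge0.
  - by apply: measurable_funTS; apply/measurable_EFinP; exact: measurable_ridge.
  - by move=> y _; rewrite lee_fin ridge_ge0.
  - exact: mAC.
  have -> := finI 1%R; last by rewrite eqxx.
  have -> := finI (-1)%R; last by rewrite eqxx orbT.
  by rewrite -EFinD mulrDl !mul1r.
have canc (x y z : \bar R) : z \is a fin_num -> x + z = y + z -> x = y.
  by move=> zf /(congr1 (fun t => t - z)); rewrite !addeK.
have fA : \int[mm]_(y in A) (f y)%:E = \int[mm]_(y in A) (2 * a)%:E.
  have h1 := split_int f mf f0.
  have h2 := split_int (fun=> 2 * a)%R (measurable_cst _) (fun=> mulr_ge0 (ler0n _ 2) (ltW a0)).
  rewrite Ef fC in h1; rewrite Ea finA in h2.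
  apply: (canc _ _ (2 * (a * U))%:E); [by []|exact: etrans (esym h1) h2].
have w0 y : A y -> (0 <= 2 * a - f y)%R.
  move=> Ay; rewrite subr_ge0 /f /ridge mul1r mulN1r.
  have yL := AL y Ay; have := yL; rewrite ltr_norml => /andP[yL1 yL2].
  rewrite !tpowE; [|lra|lra].
  have [y0|y0] := eqVneq (y ord0 i) 0%R; last exact/ltW/powR_strictly_concave.
  by rewrite y0 addr0 subr0 mulr_natl mulr2n.
have wA : \int[mm]_(y in A) (2 * a - f y)%:E = 0.
  have : \int[mm]_(y in A) (f y)%:E + \int[mm]_(y in A) (2 * a - f y)%:E =
      \int[mm]_(y in A) (f y)%:E.
    rewrite [RHS]fA -ge0_integralD; first last.
    - apply: measurable_funTS; apply/measurable_EFinP.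
      by apply: measurable_funB => //.
    - by move=> y Ay; rewrite lee_fin w0.
    - exact: mfD.
    - by move=> y _; rewrite lee_fin f0.
    - exact: mA.
    by apply: eq_integral => y _; rewrite -EFinD subrKC.
  have ffin : \int[mm]_(y in A) (f y)%:E \is a fin_num.
    rewrite ge0_fin_numE; last by apply: integral_ge0 => y _; rewrite lee_fin f0.
    by apply: le_lt_trans (K_lty); rewrite -Ef; exact: sub_int.
  move=> E; apply: (canc _ _ _ ffin); rewrite add0e addeC; exact: E.
(* Nonnegativity of 2 a - f is known on [A] only; the extension by 0 is a function to which
   [ge0_integral_mean_measure] applies. *)
pose w y := (if y \in A then 2 * a - f y else 0)%R.
split; [|exact: w0|].
  (* If [mean_const] were 0, as it is by default when the integral it inverts is 0 or infinite, the
     measure would vanish and [U] with it. *)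
  rewrite lt_neqAle mean_const_ge0 andbT eq_sym; apply: contra_neq U_neq0 => c0.
  rewrite /U [mm _](_ : _ = 0)//= /mean_measure integral0_eq// => y _.
  by rewrite c0 mul0r.
have mw : measurable_fun setT w.
  apply: measurable_fun_ifT => //; last exact: measurable_funB.
  by apply: (measurable_fun_bool true); rewrite setTI preimage_mem_true.
have ww0 y : (0 <= w y)%R.
  by rewrite /w; case: ifPn => // /set_mem /w0.
have := ge0_integral_mean_measure s r mw ww0.
have -> : \int[mean_measure s r]_y (w y)%:E = 0.
  rewrite -[RHS]wA [RHS]integral_mkcond; apply: eq_integral => y _.
  by rewrite patchE /w; case: ifP.
move=> E; rewrite [RHS]E integral_mkcond; apply: eq_integral => y _.
by rewrite patchE /w; case: ifP => _; rewrite ?mul0r.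
Qed.

End defect.

Theorem theorem1p1 (R : realType) (n : nat) (s : R) (Omega : set 'rV[R]_n) :
  (0 < n)%N ->
  0 < s < 1 ->
  open Omega ->
  bounded_set Omega ->
  Omega 0 ->
  let r := dist_to 0 (boundary Omega) in
  (forall u : 'rV[R]_n -> R, Hs s Omega u ->
     u 0 = (fine (mean_measure s r (~` Omega)))^-1 *
           \int[mean_measure s r]_(y in ~` Omega) u y) ->
  Omega = eball r.
Proof.
move=> n0 s01 oO bO O0 r H; have /andP[s0 s1] := s01.
pose i := Ordinal n0.
have r0 : 0 < r by exact: (dist_boundary_gt0 i oO bO O0).
apply/seteqP; split; last exact: eball_sub_open.
move=> q Oq; apply: contrapT => qr.
have [M M0 OM] := bounded_coord bO.
(* [M] keeps the ridge arguments positive on [Omega], 2 is the lower bound in [Hs_ridge], and [r]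
   gives r < L for the mean value formula. *)
pose L := M + 2 + r.
have rL : 0 < r < L by rewrite r0 /L; lra.
have OL x : Omega x -> `|x ord0 i| < L.
  by move=> /OM /(_ i) xM; rewrite /L; lra.
have mean sg : `|sg| <= 1 -> L `^ s = (fine (mean_measure s r (~` Omega)))^-1 *
    \int[mean_measure s r]_(y in ~` Omega) ridge i s L sg y.
  move=> sg1; rewrite -H.
    by rewrite /ridge mxE mulr0 addr0 tpowE// /L; lra.
  apply: Hs_ridge => //; first by rewrite /L; lra.
  move=> x /OL xL; have : `|sg * x ord0 i| < L.
    by rewrite normrM (le_lt_trans _ xL)// -[leRHS]mul1r ler_wpM2r.
  by rewrite ltr_norml => /andP[h _]; rewrite -ltrBlDl sub0r.
have mO := measurable_open_rV oO.
have [c0 w0 E] := ridge_defect_null s01 rL mO OL mean.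
have [p [d d0 pd]] := rbox_away i oO Oq.
pose g y := (2 * L `^ s - (ridge i s L 1 y + ridge i s L (-1) y)) * mean_density s r y.
have g_ge0 y : Omega y -> 0 <= g y.
  by move=> Oy; rewrite mulr_ge0 ?mean_density_ge0// w0.
have g_gt0 y : rbox p d y -> 0 < g y.
  (* Strict concavity takes y_i != 0, and the kernel takes |y| > r strictly: at |y| = r its
     denominator is 0 and so, by default, is the quotient. *)
  move=> /pd[Oy qy yi].
  have rq : r <= enorm q by rewrite leNgt; exact/negP.
  have ry : r < enorm y by exact: le_lt_trans qy.
  have y0 : 0 < enorm y by exact: lt_trans ry.
  apply: mulr_gt0.
    have yL := OL y Oy; have := yL; rewrite ltr_norml => /andP[yL1 yL2].
    rewrite subr_gt0 /ridge mul1r mulN1r !tpowE; [|lra|lra].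
    exact: powR_strictly_concave.
  rewrite /mean_density (ltW ry) mulr_gt0// /mean_kernel divr_gt0 ?powR_gt0//.
  rewrite mulr_gt0 ?exprn_gt0// powR_gt0// subr_gt0 ltrXn2r ?nnegrE ?(ltW r0) ?(ltW y0)//.
have mg D : measurable_fun D (fun y => (g y)%:E).
  apply: measurable_funTS; apply/measurable_EFinP; apply: measurable_funM.
    by apply: measurable_funB => //; apply: measurable_funD; exact: measurable_ridge.
  exact: measurable_mean_density.
have mbox := measurable_rbox p d.
have null : (\int[lebesgue_rV R n]_(y in rbox p d) `|(g y)%:E| = 0)%E.
  apply/eqP; rewrite eq_le; apply/andP; split; last by apply: integral_ge0 => y _; exact: abse_ge0.
  rewrite -E (eq_integral (fun y => (g y)%:E)); last first.
    by move=> y; rewrite inE => /g_gt0 gy; rewrite gee0_abs// lee_fin ltW.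
  apply: ge0_subset_integral => //.
  by move=> y /pd[].
(* [g] vanishes almost everywhere on the cube and is positive at each of its points, so the whole
   cube lies in the null set [N], against its positive volume. *)
have /(ae_eq_integral_abs _ mbox (mg _)) [N [mN N0 sub]] := null.
have : (lebesgue_rV R n (rbox p d) <= lebesgue_rV R n N)%E.
  apply: le_measure; rewrite ?inE// => y py; apply: sub => /= /(_ py) [g0].
  by have := g_gt0 y py; rewrite g0 ltxx.
rewrite [X in (_ <= X)%E]N0 lebesgue_rV_rbox// lee_fin leNgt => /negP; apply.
by rewrite exprn_gt0// mulr_gt0.
Qed.
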